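(* Let $X$ and $Y$ be infinite-dimensional real Banach spaces. Assume that $X$ is net equivalent to $Y$ and that (the norm of) $X$ is asymptotically uniformly smooth. Then $Y$ admits an equivalent asymptotically uniformly smooth norm. More precisely, if there are $C>0$ and $p\in(1,\infty)$ such that $\overline{\rho}_X(t)\le Ct^p$ for all $t\in(0,1]$, then for every $\varepsilon>0$, $Y$ admits an equivalent norm $\|\cdot\|_\varepsilon$ such that, for some constant $C_\varepsilon>0$, $\overline{\rho}_{\|\cdot\|_\varepsilon}(t)\le C_\varepsilon t^{p-\varepsilon}$ for all $t\in(0,1]$.
   Context: All Banach spaces are real. For a Banach space $(X,\|\cdot\|)$ with unit sphere $S_X$, $t>0$, $x\in S_X$ and $Z$ a closed linear subspace of $X$, put $\overline{\rho}(t,x,Z)=\sup_{z\in S_Z}\|x+tz\|-1$, and $$\overline{\rho}_X(t)=\overline{\rho}_{\|\cdot\|}(t)=\sup_{x\in S_X}\ \inf_{\dim(X/Z)<\infty}\overline{\rho}(t,x,Z),$$ where the infimum is over closed linear subspaces $Z$ of $X$ of finite codimension. The norm is asymptotically uniformly smooth (AUS) if $\lim_{t\to0}\overline{\rho}_X(t)/t=0$. For $0<a\le b$, an $(a,b)$-net in a metric space $(M,d)$ is a subset $\mathcal M\subset M$ such that $d(z,z')\ge a$ for all $z\ne z'$ in $\mathcal M$ and $d(x,\mathcal M)<b$ for every $x\in M$. A net is an $(a,b)$-net for some $0<a\le b$. Two metric spaces are Lipschitz equivalent if there is a bijection $f$ between them such that $f$ and $f^{-1}$ are Lipschitz. Two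 infinite-dimensional Banach spaces $X$ and $Y$ are net equivalent if there exist a net in $X$ and a net in $Y$ that are Lipschitz equivalent (with the metrics induced by the norms). *)

(* Defs.v *)
From mathcomp Require Import all_boot all_order all_algebra.
From mathcomp Require Import all_classical all_reals all_analysis.
Import Order.TTheory GRing.Theory Num.Theory numFieldNormedType.Exports.

Set Implicit Arguments.
Unset Strict Implicit.
Unset Printing Implicit Defensive.

Local Open Scope classical_set_scope.
Local Open Scope ring_scope.

(* dim (X / Z) < oo: the classes of finitely many vectors span X / Z. *)
Definition finite_codim (R : realType) (X : lmodType R) (Z : set X) : Prop :=
  exists e : seq X, forall x : X, exists c : 'I_(size e) -> R,
    Z (x - \sum_(i < size e) c i *: e`_i).

(* The quotient of X by the zero subspace is X itself. *)
Definition infinite_dim (R : realType) (X : lmodType R) : Prop :=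
  ~ finite_codim [set 0 : X].

Definition is_norm (R : realType) (X : lmodType R) (N : X -> R) : Prop :=
  [/\ forall x y, N (x + y) <= N x + N y,
      forall (a : R) x, N (a *: x) = `|a| * N x &
      forall x, N x = 0 -> x = 0].

Definition equivalent_norm (R : realType) (X : normedModType R)
    (N : X -> R) : Prop :=
  is_norm N /\ exists c C : R,
    [/\ 0 < c, 0 < C & forall x, c * `|x| <= N x <= C * `|x|].

Definition unit_sphere (R : realType) (X : lmodType R) (N : X -> R) : set X :=
  [set x | N x = 1].

(* Closedness refers to the topology of X.  The functions N below are the norm
   of X or an equivalent norm, which has the same closed subspaces. *)
Definition closed_finite_codim_subspace (R : realType) (X : normedModType R) :
    set (set X) :=
  [set Z | [/\ submod_closed [in Z], closed Z & finite_codim Z]].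

(* When X is infinite-dimensional and N is a norm equivalent to that of X, every
   sup and inf below is taken over a nonempty bounded set of reals, so that the
   values sup and inf take by default play no role. *)
Definition asym_smooth_at (R : realType) (X : normedModType R) (N : X -> R)
    (t : R) (x : X) (Z : set X) : R :=
  sup [set N (x + t *: z) | z in Z `&` unit_sphere N] - 1.

Definition asym_smooth (R : realType) (X : normedModType R) (N : X -> R)
    (t : R) : R :=
  sup [set inf [set asym_smooth_at N t x Z
                  | Z in @closed_finite_codim_subspace R X]
        | x in unit_sphere N].

Definition AUS (R : realType) (X : normedModType R) (N : X -> R) : Prop :=
  asym_smooth N t / t @[t --> 0^'+] --> (0 : R).

(* The infimum is extended-real, hence +oo for empty M: no net is empty. *)
Definition is_ab_net (R : realType) (X : normedModType R) (a b : R)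
    (M : set X) : Prop :=
  (forall z w, M z -> M w -> z <> w -> a <= `|z - w|) /\
  (forall x, (ereal_inf [set `|x - z|%:E | z in M] < b%:E)%E).

Definition is_net (R : realType) (X : normedModType R) (M : set X) : Prop :=
  exists a b : R, 0 < a <= b /\ is_ab_net a b M.

(* f and g are total functions, but only f on M and g on L matter. *)
Definition Lipschitz_equivalent (R : realType) (X Y : normedModType R)
    (M : set X) (L : set Y) : Prop :=
  exists (f : X -> Y) (g : Y -> X),
    [/\ set_bij M L f, {in M, cancel f g},
        [lipschitz f x | x in M] & [lipschitz g y | y in L]].

Definition net_equivalent (R : realType) (X Y : normedModType R) : Prop :=
  exists (M : set X) (L : set Y),
    [/\ is_net M, is_net L & Lipschitz_equivalent M L].

(* Main.v *)
(* A functional u on Y has asymptotic Lipschitz constants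
     |u|_k = sup u(f x - f x') / |x - x'|   over x, x' in the net with |x - x'| >= 8^k,
   where f is the Lipschitz equivalence of the nets.  The Gorelik principle, which
   follows from the Poincare-Miranda theorem, together with the asymptotic
   smoothness of X at a scale r, shows that for v weak* close to u with
   |v - u| > tau one has |v|_k + |u|_k >= 2 |u|_(k+1) + c tau r.  Hence long averages
   Theta_j of the |.|_k increase by c tau_j r_j under such perturbations, where
   tau_j = 2^-j.  The norm of Y whose dual norm is |u| + sum_j w_j Theta_j(u) has
   modulus at most C t 2^-j as soon as C t <= w_i r_i for all i <= j. *)
Require Import Defs.
From HB Require Import structures.
From mathcomp Require Import all_boot all_order all_algebra.
From mathcomp Require Import all_classical all_reals all_analysis.
From mathcomp Require Import lra.
Import Order.TTheory GRing.Theory Num.Theory numFieldNormedType.Exports.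
Set Implicit Arguments.
Unset Strict Implicit.
Unset Printing Implicit Defensive.

Local Open Scope classical_set_scope.
Local Open Scope ring_scope.

(** * The Poincare-Miranda theorem *)

(** The equivalence is given on nets only, so every estimate carries an additive error; quotients
    over distances at least 8^k make this error negligible for large k.

    A bound on N(y + t z) for all z in a subspace of finite codimension has to be proved for each
    functional v of the new dual ball. Weak* compactness leaves finitely many u, and on their common
    kernel v z = (v - u) z for one of them. If v - u is small, the bound is immediate; if not, u
    must be markedly smaller than v in the new dual norm, so that v y falls short of N y. One
    Theta_j yields this only for |v - u| > tau_j, by an amount fixed by r_j, whence one term per
    level. The weights have to be summable, which makes w_j r_j smaller than r_j; the loss of eps in
    the exponent pays for it. *)

Section CubicalCup.
Context {n : nat}.
Local Open Scope nat_scope.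
Implicit Types (a : 'I_n -> nat) (i j : 'I_n).

Definition upd a i c : 'I_n -> nat := fun j => if j == i then c else a j.
Definition step a i := upd a i (a i).+1.

Lemma updC a i j c d : i != j -> upd (upd a i c) j d = upd (upd a j d) i c.
Proof.
move=> ij; apply/funext => k; rewrite /upd.
by case: (eqVneq k j) ij => [->|//]; rewrite eq_sym; case: eqVneq.
Qed.

Lemma upd_upd a i c d : upd (upd a i c) i d = upd a i d.
Proof. by apply/funext => k; rewrite /upd; case: eqVneq. Qed.

Lemma upd_eq a i c : upd a i c i = c.
Proof. by rewrite /upd eqxx. Qed.

Lemma upd_neq a i j c : j != i -> upd a i c j = a j.
Proof. by rewrite /upd => /negPf ->. Qed.

Lemma stepC a i j : i != j -> step (step a i) j = step (step a j) i.
Proof.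
move=> ij; rewrite /step [upd a i _ j]upd_neq 1?eq_sym //.
by rewrite [upd a j _ i]upd_neq // updC.
Qed.

Local Open Scope ring_scope.

Lemma addF2 (x : 'F_2) : x + x = 0.
Proof. by apply: addrr_pchar2; rewrite inE /=. Qed.

(* The cup product of the coboundaries of the 0-cochains in [hs], evaluated on
   the cube with base point [a] and directions [S]: it counts modulo 2 the
   monotone edge paths of the cube along whose k-th step the k-th cochain
   changes. *)
Fixpoint cup (hs : seq (('I_n -> nat) -> 'F_2)) (S : {set 'I_n}) a : 'F_2 :=
  if hs is h :: t then
    \sum_(i in S) (h a + h (step a i)) * cup t (S :\ i)%SET (step a i)
  else 1.

Lemma cup_cons h t (S : {set 'I_n}) a : cup (h :: t) S a =
  \sum_(i in S) (h a + h (step a i)) * cup t (S :\ i)%SET (step a i).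
Proof. by []. Qed.

(** The terms of the ordered pairs (i, j) and (j, i) cancel modulo 2. *)
Lemma sum_sym_F2 (S : {set 'I_n}) (G : 'I_n -> 'I_n -> 'F_2) :
  (forall i j, i != j -> G i j = G j i) ->
  \sum_(i in S) \sum_(j in (S :\ i)%SET) G i j = 0.
Proof.
move=> Gs; pose P i j := [&& i \in S, j \in S & (i < j)%N].
have lt_sum (H : 'I_n -> 'I_n -> 'F_2) :
    \sum_(i in S) \sum_(j in (S :\ i)%SET) H i j =
    \sum_i \sum_(j | P i j) H i j + \sum_i \sum_(j | P j i) H i j.
  rewrite -big_split [LHS]big_mkcond /=; apply: eq_bigr => i _.
  rewrite big_mkcond [X in _ = X + _]big_mkcond [X in _ = _ + X]big_mkcond.
  rewrite -big_split; case: ifP => iS; last first.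
    by rewrite big1 // => j _ /=; rewrite /P iS andbF addr0.
  apply: eq_bigr => j _; rewrite /P !inE iS -val_eqE /=.
  by case: (j \in S); case: ltngtP => //= _; rewrite ?(addr0, add0r).
rewrite lt_sum [X in _ + X](exchange_big_dep xpredT) //=.
rewrite [X in _ + X](eq_bigr (fun i => \sum_(j | P i j) G i j)) ?addF2 // => i _.
apply: eq_bigr => j /and3P[_ _ ij].
by rewrite Gs // -val_eqE /= neq_ltn ij orbT.
Qed.

(** After expansion the terms symmetric in two directions cancel by [sum_sym_F2], and induction
    moves the base point in the others. In topological terms, a cup product of coboundaries has zero
    coboundary. *)
Lemma cup_cocycle hs (S : {set 'I_n}) a :
  \sum_(i in S) cup hs (S :\ i)%SET (step a i) = \sum_(i in S) cup hs (S :\ i)%SET a.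
Proof.
elim: hs S a => [|h t IH] S a //=.
transitivity (\sum_(i in S) \sum_(j in (S :\ i)%SET)
    h (step a i) * cup t (S :\ i :\ j)%SET (step (step a i) j)).
  transitivity (\sum_(i in S) \sum_(j in (S :\ i)%SET)
      h (step a i) * cup t (S :\ i :\ j)%SET (step (step a i) j) +
    \sum_(i in S) \sum_(j in (S :\ i)%SET)
      h (step (step a i) j) * cup t (S :\ i :\ j)%SET (step (step a i) j)).
    rewrite -big_split; apply: eq_bigr => i iS /=.
    by rewrite -big_split; apply: eq_bigr => j jS; rewrite mulrDl.
  rewrite [X in _ + X]sum_sym_F2 ?addr0 // => i j ij.
  by rewrite stepC // !finset.setDDl (finset.setUC [set i]%SET).
transitivity (\sum_(i in S) \sum_(j in (S :\ i)%SET)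
    h (step a i) * cup t (S :\ i :\ j)%SET (step a i)).
  by apply: eq_bigr => i iS; rewrite -!mulr_sumr IH.
symmetry.
transitivity (\sum_(i in S) \sum_(j in (S :\ i)%SET)
      h a * cup t (S :\ i :\ j)%SET (step a j) +
    \sum_(i in S) \sum_(j in (S :\ i)%SET)
      h (step a j) * cup t (S :\ i :\ j)%SET (step a j)).
  rewrite -big_split; apply: eq_bigr => i iS /=.
  by rewrite -big_split; apply: eq_bigr => j jS; rewrite mulrDl.
rewrite [X in X + _](_ : _ = 0) ?add0r; last first.
  transitivity (\sum_(i in S) \sum_(j in (S :\ i)%SET) h a * cup t (S :\ i :\ j)%SET a).
    by apply: eq_bigr => i iS; rewrite -!mulr_sumr IH.
  by apply: sum_sym_F2 => i j ij; rewrite !finset.setDDl (finset.setUC [set i]%SET).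
rewrite (exchange_big_dep (mem S)) /=; last by move=> i j _ /setD1P[].
apply: eq_bigr => j jS; apply: eq_big => [i|i /andP[iS /setD1P[ji _]]].
  by rewrite !inE jS andbT eq_sym andbC.
by rewrite !finset.setDDl (finset.setUC [set i]%SET).
Qed.

(** The Leibniz rule, [cup t] being a cocycle. Each summand is now a difference modulo 2 in a single
    direction, ready to telescope. *)
Lemma cup_coboundary h t S a : cup (h :: t) S a =
  \sum_(i in S) (h a * cup t (S :\ i)%SET a +
                 h (step a i) * cup t (S :\ i)%SET (step a i)).
Proof.
rewrite big_split /= -mulr_sumr -cup_cocycle mulr_sumr -big_split.
by apply: eq_bigr => i _ /=; rewrite mulrDl.
Qed.

Context (K : nat).

(** Summing one direction at a time lets each be telescoped separately. Coordinates outside [s] stay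
    those of [a], so an induction can restrict to a face. *)
Fixpoint box_sum (s : seq 'I_n) (F : ('I_n -> nat) -> 'F_2) a : 'F_2 :=
  if s is i :: s' then
    box_sum s' (fun b => \sum_(c < K) F (upd b i c)) a
  else F a.

Lemma eq_box_sum s F G a : F =1 G -> box_sum s F a = box_sum s G a.
Proof. by move=> /funext ->. Qed.

Lemma box_sum0 s a : box_sum s (fun=> 0) a = 0.
Proof.
elim: s => //= i s IH; rewrite -[RHS]IH; apply: eq_box_sum => b.
by rewrite big1.
Qed.

Lemma box_sum_sum (I : finType) (P : pred I) s (F : I -> _) a :
  box_sum s (fun b => \sum_(i | P i) F i b) a =
  \sum_(i | P i) box_sum s (F i) a.
Proof.
elim: s F => //= i s IH F; rewrite -IH; apply: eq_box_sum => b.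
by rewrite exchange_big.
Qed.

Lemma box_sum_vanish s F j a : j \in s ->
  (forall b, \sum_(c < K) F (upd b j c) = 0) -> box_sum s F a = 0.
Proof.
elim: s F => //= i s IH F; rewrite inE => + F0.
have [ji _|ji /= js] := eqVneq j i.
  rewrite {}ji in F0; by rewrite -[RHS](box_sum0 s a); apply: eq_box_sum.
apply: IH => // b; rewrite exchange_big big1 // => c _.
by rewrite -[RHS](F0 (upd b i c)); apply: eq_bigr => d _; rewrite updC.
Qed.

Lemma box_sum_upd s F i c a : i \notin s ->
  box_sum s (fun b => F (upd b i c)) a = box_sum s F (upd a i c).
Proof.
elim: s F => //= j s IH F; rewrite inE negb_or => /andP[ij js].
rewrite -IH //; apply: eq_box_sum => b; apply: eq_bigr => d _.
by rewrite updC // eq_sym.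
Qed.

Lemma box_sum_neq0 s F a : box_sum s F a != 0 ->
  exists b, [/\ F b != 0, forall i, i \in s -> (b i < K)%N &
                forall i, i \notin s -> b i = a i].
Proof.
elim: s F => [|i s IH] F /=; first by exists a.
move=> /IH[b [+ b1 b2]] => Fb.
have [c Fc] : exists c : 'I_K, F (upd b i c) != 0.
  apply/existsP; apply: contra_neqT Fb; rewrite negb_exists => /forallP F0.
  by rewrite big1 // => c _; apply/eqP; rewrite -[_ == _]negbK F0.
exists (upd b i c); split=> // j; rewrite inE.
  by have [->|ji /b1] := eqVneq j i; rewrite ?upd_eq ?ltn_ord // upd_neq.
by rewrite negb_or => /andP[ji js]; rewrite upd_neq ?b2.
Qed.

Lemma telescope_F2 (F : nat -> 'F_2) m :
  \sum_(c < m) (F c + F c.+1) = F 0%N + F m.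
Proof.
elim: m => [|m IH]; first by rewrite big_ord0 addF2.
by rewrite big_ord_recr /= IH addrA -[X in X + _ = _]addrA addF2 addr0.
Qed.

(** A cube without the direction [j] stays in one face; a cochain constant on that face has zero
    coboundary there and kills every product containing it. *)
Lemma cup_const_face (t : seq (('I_n -> nat) -> 'F_2)) (S : {set 'I_n})
    j c a : j \notin S ->
  (exists2 h, h \in t & forall b, h (upd b j c) = h (upd (fun=> 0%N) j c)) ->
  cup t S (upd a j c) = 0.
Proof.
elim: t S a => [|g t IH] S a jS [h //]; rewrite inE => ht hc.
have st i : i \in S -> step (upd a j c) i = upd (step a i) j c.
  move=> iS; have ij : i != j by apply: contraNneq jS => <-.
  by rewrite /step upd_neq // updC // eq_sym.
rewrite cup_cons big1 // => i iS; rewrite st //; case/orP: ht => [/eqP <-|ht].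
  by rewrite hc [h (upd (step _ _) _ _)]hc addF2 mul0r.
by rewrite IH ?mulr0 ?inE ?(negPf jS) ?andbF //; exists h.
Qed.

Context (h : 'I_n -> ('I_n -> nat) -> 'F_2).
Hypothesis h_low : forall i a, a i = 0%N -> h i a = 0.
Hypothesis h_high : forall i a, a i = K -> h i a = 1.

(* Each coboundary term telescopes in its own direction.  In direction j <> i the
   cochain [h j] is constant on both faces, so these terms vanish; in direction i
   the upper face is left, on which [h i] is 1. *)
Lemma box_sum_cup s a : uniq s ->
  box_sum s (cup (map h s) [set:: s]%SET) a = 1.
Proof.
elim: s a => [//|i s IH] a; rewrite cons_uniq => /andP[iNs us].
have sD : ([set:: i :: s] :\ i)%SET = [set:: s]%SET.
  apply/setP => j; rewrite !inE; case: eqVneq => [->|//]; exact/esym/negbTE.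
pose phi j b := h i b * cup (map h s) ([set:: i :: s] :\ j)%SET b.
have tele j b : \sum_(c < K) (phi j (upd b j c) + phi j (step (upd b j c) j)) =
    phi j (upd b j 0%N) + phi j (upd b j K).
  rewrite -(telescope_F2 (fun c => phi j (upd b j c))).
  by apply: eq_bigr => c _; rewrite /step upd_upd upd_eq.
have -> : cup (map h (i :: s)) [set:: i :: s]%SET =
    fun b => \sum_(j in [set:: i :: s]%SET) (phi j b + phi j (step b j)).
  by apply/funext => b; rewrite cup_coboundary.
have zero j : j \in s -> box_sum (i :: s)
    (fun b => phi j b + phi j (step b j)) a = 0.
  move=> js; apply: (@box_sum_vanish _ _ j); first by rewrite inE js orbT.
  move=> b; rewrite tele /phi !cup_const_face ?mulr0 ?addr0 // ?inE ?eqxx //;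
    exists (h j); rewrite ?map_f // => d.
    by rewrite !h_high ?upd_eq.
  by rewrite !h_low ?upd_eq.
rewrite box_sum_sum (bigD1 i) ?inE ?eqxx //=.
rewrite [X in _ + X]big1 ?addr0; last first.
  by move=> j /andP[+ ji]; rewrite !inE (negPf ji) => /zero.
rewrite -[RHS](IH (upd a i K)) // -box_sum_upd //; apply: eq_box_sum => b.
by rewrite tele /phi h_low ?h_high ?upd_eq // mul0r mul1r add0r sD.
Qed.

Lemma cup_neq0 hs (S : {set 'I_n}) a g : cup hs S a != 0 -> g \in hs ->
  exists p q, [/\ forall j, (a j <= p j <= (a j).+1)%N,
                  forall j, (a j <= q j <= (a j).+1)%N & g p != g q].
Proof.
(* The induction follows a path inside the cube at [a]: [b] is its current vertex and [S] the set of
   directions not yet taken. *)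
suff cell : forall hs S b, cup hs S b != 0 -> g \in hs ->
    (forall j, (a j <= b j <= (a j).+1)%N) ->
    (forall j, j \in S -> b j = a j) ->
    exists p q, [/\ forall j, (a j <= p j <= (a j).+1)%N,
                  forall j, (a j <= q j <= (a j).+1)%N & g p != g q].
  by move=> c0 ghs; apply: (cell hs S a) => // j; rewrite leqnn leqnSn.
move=> {}hs {}S b; elim: hs S b => //= f t IH S b c0.
have [i /andP[iS]] : exists i, (i \in S) &&
    ((f b + f (step b i)) * cup t (S :\ i)%SET (step b i) != 0).
  apply/existsP; apply: contra_neqT c0; rewrite negb_exists => /forallP F0.
  by rewrite big1 // => c cS; apply/eqP; have := F0 c; rewrite cS /= negbK.
rewrite mulf_eq0 negb_or => /andP[fi ci] + ab Sb.
have ab' j : (a j <= step b i j <= (a j).+1)%N.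
  have [->|ji] := eqVneq j i; last by rewrite /step upd_neq.
  by rewrite /step upd_eq Sb // leqnn leqnSn.
rewrite inE => /predU1P[->|gt]; last first.
  apply: (IH _ _ ci gt ab') => j /setD1P[ji jS].
  by rewrite /step upd_neq // Sb.
exists b, (step b i); split=> //; apply: contraNneq fi => ->.
by rewrite addF2.
Qed.

(** The cup products of all cells add up to 1, so some cell has a nonzero product, and there each
    cochain changes along an edge. *)
Lemma discrete_poincare_miranda : exists2 a, (forall i, (a i < K)%N) &
  forall i, exists p q, [/\ forall j, (a j <= p j <= (a j).+1)%N,
                            forall j, (a j <= q j <= (a j).+1)%N &
                            h i p != h i q].
Proof.
have /box_sum_neq0[a [c0 aK _]] : box_sum (enum 'I_n)
    (cup (map h (enum 'I_n)) [set:: enum 'I_n]%SET) (fun=> 0%N) != 0.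
  by rewrite box_sum_cup ?enum_uniq // oner_neq0.
exists a => [i|i]; first by apply: aK; rewrite mem_enum.
have his : h i \in map h (enum 'I_n) by rewrite map_f ?mem_enum.
exact: cup_neq0 c0 his.
Qed.

End CubicalCup.

(** * Uniform continuity, finite nets and partitions of unity on compact sets *)

Section CompactNormed.
Context {R : realType} {V W : normedModType R}.

Lemma compact_unif_cont (K : set V) (g : V -> W) (e : R) :
  compact K -> (forall x, K x -> {for x, continuous g}) -> 0 < e ->
  \forall d \near (0:R)^'+,
    forall x y, K x -> K y -> `|x - y| < d -> `|g x - g y| < e.
Proof.
move=> /compact_near_coveringP cK gc e0.
suff : \forall d \near (0:R)^'+,
    K `<=` (fun x => forall y, K y -> `|x - y| < d -> `|g x - g y| < e).
  by apply: filterS => d dP x y Kx; apply: dP.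
apply: (cK _ _ (fun d x => forall y, K y -> `|x - y| < d -> `|g x - g y| < e)).
move=> x Kx.
have /cvgr_dist_lt /(_ (e / 2)) := gc _ Kx.
rewrite divr_gt0 // => /(_ isT) /nbhs_ballP[r /= r0 rP].
exists (ball x (r / 2), [set d | d < r / 2]).
  split; first by apply: nbhsx_ballx; rewrite divr_gt0.
  by apply: nbhs_right_lt; rewrite divr_gt0.
move=> [x' d] /= [xx' dr] y Ky xy.
have h z : `|x - z| < r -> `|g x - g z| < e / 2.
  by move=> xz; apply: rP; rewrite -ball_normE.
move: xx'; rewrite -ball_normE /= => xx'.
have xy' : `|x - y| < r.
  have := ler_normD (x - x') (x' - y); rewrite addrA subrK; lra.
have := ler_normD (g x' - g x) (g x - g y); rewrite addrA subrK.
have := h _ xy'; have : `|g x' - g x| < e / 2.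
  by rewrite distrC; apply: h; lra.
lra.
Qed.

Lemma compact_finite_net (K : set V) (d : R) : compact K -> 0 < d ->
  exists (m : nat) (a : 'I_m -> V), (forall i, K (a i)) /\
    forall x, K x -> exists i, `|x - a i| < d.
Proof.
move=> cK d0; move: cK; rewrite compact_cover.
move=> /(_ V K (fun x => ball x d)) [|x Kx|D DK Kcov].
- by move=> x _; exact: ball_open.
- by exists x => //; exact: ballxx.
exists (size (finmap.enum_fset D)), (fun i => nth 0 (finmap.enum_fset D) i).
split=> [i|x /Kcov[y /= yD]].
  by apply/set_mem/DK; rewrite mem_nth.
rewrite -ball_normE /= distrC => xy.
have iD : (index y (finmap.enum_fset D) < (size (finmap.enum_fset D)))%N by rewrite index_mem.
by exists (Ordinal iD); rewrite /= nth_index.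
Qed.

End CompactNormed.

Section PartitionOfUnity.
Context {R : realType} {V : normedModType R}.

Lemma partition_of_unity (K : set V) (d : R) : compact K -> 0 < d ->
  exists (m : nat) (a : 'I_m -> V) (p : 'I_m -> V -> R),
    (forall i, K (a i)) /\
    forall x, K x -> [/\ forall i, 0 <= p i x, \sum_i p i x = 1,
      forall i, p i x != 0 -> `|x - a i| < d &
      forall i, {for x, continuous (p i)}].
Proof.
move=> cK d0; have [m [a [aK acov]]] := compact_finite_net cK d0.
pose t i x : R := Num.max 0 (d - `|x - a i|).
pose s x := \sum_i t i x.
have t0 i x : 0 <= t i x by rewrite le_max lexx.
have tc i : continuous (t i).
  move=> x.
  apply: (@continuous_max R V (cst 0) (fun x => d - `|x - a i|)).
    exact: cst_continuous.
  apply: (@cvgB _ R^o); first exact: cvg_cst.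
  by apply: cvg_norm; apply: cvgB; [exact: cvg_id|exact: cvg_cst].
have sc : continuous s by apply: continuous_big => //; exact: add_continuous.
exists m, a, (fun i x => t i x / s x); split=> // x Kx.
have s0 : 0 < s x.
  have [i xi] := acov _ Kx.
  rewrite /s (bigD1 i) //= ltr_pwDl ?sumr_ge0 //.
  by rewrite lt_max subr_gt0 xi orbT.
split=> [i||i|i].
- by rewrite divr_ge0 // ltW.
- by rewrite -mulr_suml divff // gt_eqF.
- apply: contra_neqT; rewrite -leNgt => xa.
  by rewrite /t max_l ?mul0r // subr_le0.
apply: continuousM; first exact: tc.
by apply: continuousV; [rewrite gt_eqF|exact: sc].
Qed.

Lemma convex_sum_close (W : normedModType R) m (p : 'I_m -> R) (v : 'I_m -> W)
    (c : W) (r : R) :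
  (forall i, 0 <= p i) -> \sum_i p i = 1 ->
  (forall i, p i != 0 -> `|v i - c| <= r) ->
  `|\sum_i p i *: v i - c| <= r.
Proof.
move=> p0 p1 vr.
have -> : \sum_i p i *: v i - c = \sum_i p i *: (v i - c).
  rewrite -{1}[c]scale1r -p1 scaler_suml -sumrB.
  by apply: eq_bigr => i _; rewrite scalerBr.
rewrite -[r]mul1r -p1 mulr_suml; apply: le_trans (ler_norm_sum _ _ _) _.
apply: ler_sum => i _; rewrite normrZ ger0_norm //.
by have [->|/vr] := eqVneq (p i) 0; rewrite ?mul0r // => /ler_wpM2l; apply.
Qed.

End PartitionOfUnity.

(** * From the cubical grid to continuous functions on a cube *)

Section PoincareMiranda.
Context {R : realType} {n : nat}.
Implicit Types (q v : 'rV[R]_n) (T : R).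

Lemma rV_norm_le v T : 0 <= T -> (forall i, `|v 0 i| <= T) -> `|v| <= T.
Proof.
move=> T0 vT; rewrite /Num.norm /= mx_normrE; apply/bigmax_leP; split=> //.
by move=> [i j] _ /=; rewrite ord1.
Qed.

Lemma rV_norm_ge v i : `|v 0 i| <= `|v|.
Proof.
by rewrite [leRHS]/Num.norm /= mx_normrE; exact: (le_bigmax _ _ (0, i)).
Qed.

Lemma rV_cube_compact T : compact [set v : 'rV[R]_n | forall i, `|v 0 i| <= T].
Proof.
have := @rV_compact R n (fun=> `[- T, T]%classic) (fun=> @segment_compact R (- T) T).
congr compact; apply/seteqP; split=> v /= vT i; have := vT i;
  by rewrite in_itv /= ler_norml.
Qed.

Lemma approx_poincare_miranda (g : 'I_n -> 'rV[R]_n -> R) (T e : R) :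
  0 < T -> 0 < e ->
  (forall i (q : 'rV[R]_n), (forall j, `|q 0 j| <= T) -> {for q, continuous (g i)}) ->
  (forall i (q : 'rV[R]_n), (forall j, `|q 0 j| <= T) -> q 0 i = T -> 0 <= g i q) ->
  (forall i (q : 'rV[R]_n), (forall j, `|q 0 j| <= T) -> q 0 i = - T -> g i q <= 0) ->
  exists2 q : 'rV[R]_n, (forall j, `|q 0 j| <= T) & forall i, `|g i q| <= e.
Proof.
move=> T0 e0 gc gT gNT; pose Q := [set v : 'rV[R]_n | forall i, `|v 0 i| <= T].
have dF : \forall d \near (0:R)^'+, forall i x y, Q x -> Q y ->
    `|x - y| < d -> `|g i x - g i y| < e.
  apply: filter_forall => i.
  apply: compact_unif_cont => //; [exact: rV_cube_compact|exact: gc].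
have [d [d0 dP]] : exists d : R, 0 < d /\ forall i x y, Q x -> Q y ->
    `|x - y| < d -> `|g i x - g i y| < e.
  near (0:R)^'+ => d; exists d; split; first by near: d; exact: nbhs_right_gt.
  by near: d.
pose K := (Num.truncn (2 * T / d)).+1.
have Kd : 2 * T / K%:R < d.
  have : 2 * T / d < K%:R by rewrite truncnS_gt.
  by rewrite !ltr_pdivrMr ?ltr0n // [d * _]mulrC.
have K0 : 0 < K%:R :> R by rewrite ltr0n.
pose pt (a : 'I_n -> nat) : 'rV[R]_n := \row_i (- T + 2 * T / K%:R * (a i)%:R).
have c0 : 0 <= 2 * T / K%:R by rewrite divr_ge0 ?mulr_ge0 // ltW.
have cK : 2 * T / K%:R * K%:R = 2 * T by rewrite divfK ?gt_eqF.
have ptQ a : (forall i, a i <= K)%N -> Q (pt a).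
  move=> aK i; rewrite mxE ler_norml.
  have : 2 * T / K%:R * (a i)%:R <= 2 * T by rewrite -[leRHS]cK ler_wpM2l ?ler_nat.
  have : 0 <= 2 * T / K%:R * (a i)%:R by rewrite mulr_ge0.
  by lra.
(* The faces are imposed: [g i] may vanish on the lower one, and [h_low] and [h_high] also concern
   points whose other coordinates leave the grid, where nothing is known about [g]. *)
pose h i a : 'F_2 :=
  ((K <= a i)%N || (0 < a i)%N && (0 <= g i (pt a)))%:R.
have [i a ai|i a ai|a aK acell] := @discrete_poincare_miranda n K h.
- by rewrite /h ai.
- by rewrite /h ai leqnn.
have cell_le p : (forall j, a j <= p j <= (a j).+1)%N ->
    (forall j, p j <= K)%N.
  by move=> ap j; have /andP[_ /leq_trans] := ap j; apply.
have cell_near p : (forall j, a j <= p j <= (a j).+1)%N ->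
    `|pt a - pt p| < d.
  move=> ap; apply: le_lt_trans Kd; apply: rV_norm_le => // i.
  have := ap i; rewrite !mxE -!(ler_nat R) -natr1 => /andP[h1 h2].
  rewrite opprD addrACA subrr add0r -mulrBr normrM ger0_norm //.
  by rewrite -[leRHS]mulr1 ler_wpM2l // ler_norml; lra.
have Qa : Q (pt a) by apply: ptQ => i; exact: ltnW.
exists (pt a) => // i; have [p [q [ap aq]]] := acell i.
wlog [hp hq] : p q ap aq / h i p = 1 /\ h i q = 0.
  move=> W; rewrite /h; have := W p q ap aq; have := W q p aq ap; rewrite /h.
  case: (_ || _); case: (_ || _); rewrite ?eqxx //= => W1 W2 _.
    exact: W1.
  exact: W2.
move=> _.
have gp : 0 <= g i (pt p).
  have pK := cell_le _ ap i; have [Kp|Kp] := leqP K (p i).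
    apply: gT; first exact/ptQ/cell_le.
    by rewrite mxE (@anti_leq (p i) K) ?pK // cK; lra.
  move: hp; rewrite /h leqNgt Kp /=; case: leP => // _.
  by rewrite andbF => /eqP; rewrite eq_sym oner_eq0.
have gq : g i (pt q) <= 0.
  move: hq; rewrite /h; case: (posnP (q i)) => [q0 _|_].
    by apply: gNT; [exact/ptQ/cell_le|rewrite mxE q0 mulr0 addr0].
  case: ltP => [/ltW //|_]; rewrite orbT => /eqP; by rewrite oner_eq0.
have := dP i _ _ Qa (ptQ _ (cell_le _ ap)) (cell_near _ ap).
have := dP i _ _ Qa (ptQ _ (cell_le _ aq)) (cell_near _ aq).
by rewrite !ltr_norml ler_norml; lra.
Unshelve. all: by end_near. Qed.

End PoincareMiranda.

Section ScalarForms.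
Context {R : realType} {V : lmodType R}.
Implicit Types (u v : V -> R) (x y : V).

Lemma scalar_form0 u : scalar u -> u 0 = 0.
Proof. by move=> us; have := us 1 0 0; rewrite scaler0 addr0 mul1r; lra. Qed.

Lemma scalar_formD u x y : scalar u -> u (x + y) = u x + u y.
Proof. by move=> us; have := us 1 x y; rewrite scale1r mul1r. Qed.

Lemma scalar_formZ u a x : scalar u -> u (a *: x) = a * u x.
Proof. by move=> us; have := us a x 0; rewrite scalar_form0 // !addr0. Qed.

Lemma scalar_formN u x : scalar u -> u (- x) = - u x.
Proof. by move=> us; rewrite -scaleN1r scalar_formZ // mulN1r. Qed.

Lemma scalar_formB u x y : scalar u -> u (x - y) = u x - u y.
Proof. by move=> us; rewrite scalar_formD // scalar_formN. Qed.

Lemma scalar_form_sum u m (c : 'I_m -> R) (e : 'I_m -> V) : scalar u ->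
  u (\sum_i c i *: e i) = \sum_i c i * u (e i).
Proof.
move=> us; elim/big_ind2: _ => [|x a y b <- <-|i _]; first exact: scalar_form0.
  exact: scalar_formD.
exact: scalar_formZ.
Qed.

Lemma scalar_form_scale u a : scalar u -> scalar (fun x => a * u x).
Proof. by move=> us b x y; rewrite us mulrDr mulrCA. Qed.

End ScalarForms.

(** * The Hahn-Banach theorem and closed subspaces of finite codimension *)

Section HahnBanach.
Context {R : realType} {V : lmodType R}.
Implicit Types (p q : V -> R) (x y : V).

Definition sublinear p :=
  (forall x y, p (x + y) <= p x + p y) /\
  (forall (t : R) x, 0 <= t -> p (t *: x) = t * p x).

Lemma sublinearI p : (forall x y, p (x + y) <= p x + p y) -> p 0 = 0 ->
  (forall (t : R) x, 0 < t -> p (t *: x) <= t * p x) -> sublinear p.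
Proof.
move=> pD p0 pZ; split=> // t x; rewrite le_eqVlt => /predU1P[<-|t0].
  by rewrite scale0r p0 mul0r.
apply/eqP; rewrite eq_le pZ //=.
have := pZ t^-1 (t *: x); rewrite invr_gt0 => /(_ t0).
by rewrite scalerA mulVf ?gt_eqF // scale1r mulrC ler_pdivlMr // mulrC.
Qed.

Lemma sublinear_ge p q x : sublinear q -> (forall z, q z <= p z) ->
  - p (- x) <= q x.
Proof.
move=> [qD qZ] qp; have := qD x (- x).
have -> : q (x - x) = 0 by rewrite subrr -(scale0r 0) qZ // mul0r.
by have := qp (- x); lra.
Qed.

(* The largest sublinear function below [q] which is at most [- q y] at [- y].  A
   minimal sublinear function is therefore odd, hence linear. *)
Definition descend q y x :=
  inf [set q (x + t *: y) - t * q y | t in [set t : R | 0 <= t]].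

Section Descend.
Variables (q : V -> R) (y : V).
Hypothesis qs : sublinear q.

Lemma descend_has_inf x :
  has_inf [set q (x + t *: y) - t * q y | t in [set t : R | 0 <= t]].
Proof.
split; first by exists (q (x + 0 *: y) - 0 * q y); exists 0 => /=.
exists (- q (- x)) => _ [t /= t0 <-].
have [qD qZ] := qs; have := qD (x + t *: y) (- x).
by rewrite addrAC subrr add0r qZ //; lra.
Qed.

Lemma descend_le_at t x : 0 <= t -> descend q y x <= q (x + t *: y) - t * q y.
Proof. by move=> t0; apply: ge_inf; [case: (descend_has_inf x)|exists t]. Qed.

Lemma le_descend a x :
  (forall t : R, 0 <= t -> a <= q (x + t *: y) - t * q y) -> a <= descend q y x.
Proof.
move=> aq; apply: lb_le_inf; first by case: (descend_has_inf x).
by move=> _ [t /= t0 <-]; exact: aq.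
Qed.

Lemma descend_le x : descend q y x <= q x.
Proof. by have := @descend_le_at 0 x (lexx _); rewrite scale0r addr0 mul0r subr0. Qed.

Lemma descendN : descend q y (- y) <= - q y.
Proof.
have := @descend_le_at 1 (- y) ler01; rewrite scale1r addNr mul1r.
by case: qs => _ qZ; rewrite -(scale0r y) qZ // mul0r add0r.
Qed.

Lemma descend_sublinear : sublinear (descend q y).
Proof.
have [qD qZ] := qs; apply: sublinearI => [x z||t x t0].
- rewrite -lerBlDr; apply: le_descend => s s0.
  rewrite lerBlDl -lerBlDr; apply: le_descend => t t0; rewrite lerBlDr.
  apply: le_trans (@descend_le_at (s + t) _ _) _; first exact: addr_ge0.
  rewrite scalerDl addrACA; have := qD (x + s *: y) (z + t *: y); lra.
- apply/eqP; rewrite eq_le; apply/andP; split.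
    by apply: le_trans (descend_le _) _; rewrite -(scale0r y) qZ // mul0r.
  by apply: le_descend => t t0; rewrite add0r qZ // subrr.
- rewrite mulrC -ler_pdivrMr //; apply: le_descend => s s0.
  rewrite ler_pdivrMr //.
  apply: le_trans (@descend_le_at (t * s) _ _) _; first by rewrite mulr_ge0 // ltW.
  have -> : q (t *: x + (t * s) *: y) = t * q (x + s *: y).
    by rewrite -scalerA -scalerDr qZ // ltW.
  lra.
Qed.

End Descend.

(** Zorn's lemma for the reversed pointwise order. The infimum of a chain is finite by
    [sublinear_ge], and subadditive because the chain is total. *)
Lemma minimal_sublinear p : sublinear p -> exists q,
  [/\ sublinear q, forall x, q x <= p x &
      forall r, sublinear r -> (forall x, r x <= q x) -> r = q].
Proof.
move=> ps; pose T := {q : V -> R | sublinear q /\ forall x, q x <= p x}.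
pose le (a b : T) := `[< forall x, sval b x <= sval a x >].
have [||||[q [qs qp]] qmax] := @Zorn T le.
- by move=> a; apply/asboolP.
- move=> a b c /asboolP ab /asboolP bc; apply/asboolP => x.
  exact: le_trans (bc x) (ab x).
- move=> [a a1] [b b1] /asboolP /= ab /asboolP /= ba.
  by apply: eq_exist; apply/funext => x; apply/eqP; rewrite eq_le ab ba.
- move=> A totA; have [[a0 Aa0]|/forallNP A0] := pselect (exists a, A a); last first.
    by exists (exist _ p (conj ps (fun=> lexx _))) => s /A0.
  pose E x := [set sval a x | a in A].
  have Einf x : has_inf (E x).
    split; first by exists (sval a0 x), a0.
    by exists (- p (- x)) => _ [[a [as_ ap]] _ <-]; exact: sublinear_ge.
  pose m x := inf (E x).
  have m_le a x : A a -> m x <= sval a x.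
    by move=> Aa; apply: ge_inf; [case: (Einf x)|exists a].
  have le_m c x : (forall a, A a -> c <= sval a x) -> c <= m x.
    by move=> h; apply: lb_le_inf; [case: (Einf x)|move=> _ [a Aa <-]; exact: h].
  have ms : sublinear m.
    apply: sublinearI => [x y||t x t0].
    + rewrite -lerBlDr; apply: (le_m) => a Aa; rewrite lerBlDl -lerBlDr.
      apply: (le_m) => b Ab; rewrite lerBlDr.
      have [[/asboolP ab]|/asboolP ba] := totA _ _ Aa Ab.
        apply: le_trans (m_le _ _ Ab) _; case: b Ab ab => b [[bD _] _] /= _ ab.
        by apply: le_trans (bD _ _) _; have := ab x; lra.
      apply: le_trans (m_le _ _ Aa) _; case: a Aa ba => a [[aD _] _] /= _ ba.
      by apply: le_trans (aD _ _) _; have := ba y; lra.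
    + have z (a : T) : sval a 0 = 0.
        by case: a => a [[_ aZ] _] /=; rewrite -(scale0r 0) aZ // mul0r.
      apply/eqP; rewrite eq_le -{1}(z a0) m_le //=.
      by apply: (le_m) => a _; rewrite z.
    + rewrite mulrC -ler_pdivrMr //; apply: (le_m) => a Aa.
      rewrite ler_pdivrMr // mulrC; apply: le_trans (m_le _ _ Aa) _.
      by case: a Aa => a [[_ aZ] _] /= _; rewrite aZ // ltW.
  have mp x : m x <= p x.
    by apply: le_trans (m_le _ x Aa0) _; case: (a0) => a [_ ap] /=.
  by exists (exist _ m (conj ms mp)) => a Aa; apply/asboolP => x; exact: m_le.
exists q; split=> // r rs rq.
have rp x : r x <= p x by apply: le_trans (rq x) (qp x).
have := qmax (exist _ r (conj rs rp)).
by move=> /(_ (introT (asboolP _) rq)) /(congr1 sval).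
Qed.

(** The minimal function is taken below [descend p v] rather than [p]: its value at [- v] is then at
    most [- p v], which oddness turns into [f v = p v]. *)
Theorem hahn_banach p v : sublinear p ->
  exists f : V -> R, [/\ scalar f, forall x, f x <= p x & f v = p v].
Proof.
move=> ps; have ds := descend_sublinear v ps.
have [q [qs qd qmin]] := minimal_sublinear ds.
have qN x : q (- x) = - q x.
  have qx := qmin _ (descend_sublinear x qs) (descend_le x qs).
  apply/eqP; rewrite eq_le -{1}qx descendN //=.
  have [qD qZ] := qs; have := qD x (- x); rewrite subrr.
  by rewrite -(scale0r x) qZ // mul0r; lra.
have [qD qZ] := qs.
have qDe x y : q (x + y) = q x + q y.
  apply/eqP; rewrite eq_le qD /=.
  by have := qD (x + y) (- y); rewrite addrK qN; lra.
have qp x : q x <= p x by apply: le_trans (qd x) (descend_le v ps x).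
exists q; split=> // [a x y|].
  rewrite qDe; congr (_ + _); have [a0|a0] := leP 0 a; first exact: qZ.
  have /qZ h : 0 <= - a by lra.
  by rewrite -[in LHS](opprK a) scaleNr qN h mulNr opprK.
apply/eqP; rewrite eq_le qp /=.
by have := qd (- v); have := descendN v ps; rewrite qN; lra.
Qed.

End HahnBanach.

Section NormedForms.
Context {R : realType} {V : normedModType R}.
Implicit Types (u : V -> R) (x y : V) (Z : set V).

Lemma norm_sublinear : sublinear (fun x : V => `|x|).
Proof.
by split=> [x y|t x t0]; [exact: ler_normD|rewrite normrZ ger0_norm].
Qed.

Lemma norming_form x : exists u, [/\ scalar u, forall y, u y <= `|y| & u x = `|x|].
Proof. exact: hahn_banach norm_sublinear. Qed.

Lemma scalar_form_abs u (c : R) : scalar u -> (forall y, u y <= c * `|y|) ->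
  forall y, `|u y| <= c * `|y|.
Proof.
move=> us uc y; rewrite ler_norml uc andbT.
by have := uc (- y); rewrite scalar_formN // normrN; lra.
Qed.

Lemma scalar_form_continuous u (c : R) :
  scalar u -> (forall y, u y <= c * `|y|) -> continuous u.
Proof.
move=> us uc x; apply/cvgrPdist_lt => e e0.
have c0 : 0 < `|c| + 1 by rewrite ltr_wpDl.
have d0 : 0 < e / (`|c| + 1) by rewrite divr_gt0.
near=> y; rewrite -scalar_formB //.
apply: le_lt_trans (scalar_form_abs us uc _) _.
have : `|x - y| < e / (`|c| + 1).
  by near: y; apply: cvgr_dist_lt d0; exact: cvg_id.
rewrite ltr_pdivlMr // mulrDr mulr1; apply: le_lt_trans.
by rewrite mulrC -[leLHS]addr0 lerD // ler_wpM2l // ler_norm.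
Unshelve. all: by end_near. Qed.

Definition dist_to Z x := inf [set `|x - z| | z in Z].

Section DistToSubspace.
Variable Z : set V.
Hypothesis Z_sub : submod_closed [in Z].

Let Z0 : Z 0. Proof. by case: Z_sub => /set_mem. Qed.
Lemma subspaceP a x y : Z x -> Z y -> Z (a *: x + y).
Proof. by case: Z_sub => _ h zx zy; apply/set_mem/h; apply/mem_set. Qed.
Lemma subspaceZ a x : Z x -> Z (a *: x).
Proof. by move=> zx; have := subspaceP a zx Z0; rewrite addr0. Qed.
Lemma subspaceD x y : Z x -> Z y -> Z (x + y).
Proof. by move=> zx zy; have := subspaceP 1 zx zy; rewrite scale1r. Qed.
Lemma subspaceB x y : Z x -> Z y -> Z (x - y).
Proof. by move=> zx zy; rewrite addrC -scaleN1r; exact: subspaceP. Qed.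

Lemma dist_to_has_inf x : has_inf [set `|x - z| | z in Z].
Proof.
split; first by exists `|x - 0|, 0.
by exists 0 => _ [z _ <-].
Qed.

Lemma dist_to_le z x : Z z -> dist_to Z x <= `|x - z|.
Proof. by move=> Zz; apply: ge_inf; [case: (dist_to_has_inf x)|exists z]. Qed.

Lemma le_dist_to a x : (forall z, Z z -> a <= `|x - z|) -> a <= dist_to Z x.
Proof.
move=> h; apply: lb_le_inf; first by case: (dist_to_has_inf x).
by move=> _ [z Zz <-]; exact: h.
Qed.

Lemma dist_to_ge0 x : 0 <= dist_to Z x.
Proof. exact: le_dist_to. Qed.

Lemma dist_to_approx x (e : R) : 0 < e -> exists2 z, Z z & `|x - z| < dist_to Z x + e.
Proof.
by move=> e0; have [_ [z Zz <-] h] := inf_adherent e0 (dist_to_has_inf x); exists z.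
Qed.

Lemma dist_to_norm x : dist_to Z x <= `|x|.
Proof. by have := dist_to_le x Z0; rewrite subr0. Qed.

Lemma dist_to_sublinear : sublinear (dist_to Z).
Proof.
apply: sublinearI => [x y||t x t0].
- apply/ler_addgt0Pr => e e0; have e20 : 0 < e / 2 by rewrite divr_gt0.
  have [z Zz hz] := dist_to_approx x e20; have [w Zw hw] := dist_to_approx y e20.
  apply: le_trans (dist_to_le _ (subspaceD Zz Zw)) _.
  by rewrite opprD addrACA; have := ler_normD (x - z) (y - w); lra.
- by have := dist_to_norm 0; have := dist_to_ge0 0; rewrite normr0; lra.
- rewrite mulrC -ler_pdivrMr //; apply: le_dist_to => z Zz.
  rewrite ler_pdivrMr // mulrC -{2}(ger0_norm (ltW t0)) -normrZ scalerBr.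
  exact/dist_to_le/subspaceZ.
Qed.

Lemma dist_to_gt0 x : closed Z -> ~ Z x -> 0 < dist_to Z x.
Proof.
move=> cZ Zx; rewrite lt_neqAle dist_to_ge0 andbT eq_sym; apply: contra_notN Zx => /eqP d0.
apply: cZ => U /nbhs_ballP[e /= e0 eU].
have [z Zz] := dist_to_approx x e0; rewrite d0 add0r => xz.
by exists z; split=> //; apply: eU; rewrite -ball_normE.
Qed.

(** Hahn-Banach for the distance to [Z], which vanishes on [Z] and is positive at [v]. *)
Lemma separating_form v : closed Z -> ~ Z v -> exists (u : V -> R) (c : R),
  [/\ scalar u, forall y, u y <= c * `|y|, u v = 1 & forall z, Z z -> u z = 0].
Proof.
move=> cZ Zv; have d0 := dist_to_gt0 cZ Zv.
have [f [fs fd fv]] := hahn_banach v dist_to_sublinear.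
have fZ z : Z z -> f z <= 0.
  by move=> Zz; apply: le_trans (fd z) _; have := dist_to_le z Zz; rewrite subrr normr0.
exists (fun x => (dist_to Z v)^-1 * f x), (dist_to Z v)^-1; split=> [|y||z Zz].
- exact: scalar_form_scale.
- rewrite ler_pM2l ?invr_gt0 //; exact: le_trans (fd y) (dist_to_norm y).
- by rewrite fv mulVf // gt_eqF.
have := fZ _ (subspaceZ (-1) Zz); rewrite scaleN1r scalar_formN // => h.
suff -> : f z = 0 by rewrite mulr0.
by have := fZ _ Zz; lra.
Qed.

End DistToSubspace.

Lemma finite_codim_coords Z : @closed_finite_codim_subspace R V Z ->
  exists (n : nat) (F : 'I_n -> V -> R) (c : 'I_n -> R) (e : 'I_n -> V),
    (forall i, scalar (F i) /\ forall y, F i y <= c i * `|y|) /\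
    [/\ forall i z, Z z -> F i z = 0,
        forall i j, F i (e j) = (i == j)%:R &
        forall x, Z (x - \sum_i F i x *: e i)].
Proof.
move=> [Zs cZ [s sP]]; elim: s Z Zs cZ sP => [|v s IH] Z Zs cZ sP.
  exists 0%N, (fun i _ => 0), (fun=> 0), (fun=> 0); split; first by case.
  by split=> [[]//|[]//|x]; have [c] := sP x; rewrite !big_ord0.
have [Zv|Zv] := pselect (Z v).
  apply: IH => // x; have [c] := sP x; rewrite big_ord_recl /= => h.
  exists (fun i => c (lift ord0 i)).
  have := subspaceP Zs (c ord0) Zv h; congr Z.
  by rewrite opprD !addrA [_ + x]addrC addrK.
have [f [b [fs fb fv fZ]]] := separating_form Zs cZ Zv.
(* This is [Z] plus the line of [v]; as the preimage of [Z] under a continuous projection it is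
   closed. *)
pose Z' := [set x | Z (x - f x *: v)].
have [||x|n [F [c [e [Fs [FZ Fe ZF]]]]]] := IH Z'.
- split; first by apply/mem_set; rewrite /Z' /= scalar_form0 // scale0r subr0; case: Zs => /set_mem.
  move=> a x y /set_mem /= Zx /set_mem /= Zy; apply/mem_set; rewrite /Z' /=.
  have := subspaceP Zs a Zx Zy; rewrite fs scalerBr scalerDl scalerA opprD addrACA.
  by [].
- have := @closed_comp _ _ (fun x => x - f x *: v) Z _ cZ.
  apply=> x _; apply: cvgB; first exact: cvg_id.
  by apply: cvgZl; exact: scalar_form_continuous fs fb x.
- have [c] := sP x; rewrite big_ord_recl /= => h.
  exists (fun i => c (lift ord0 i)); rewrite /Z' /=.
  set y := \sum_(i < _) _ in h *.
  have fy : f (x - (c ord0 *: v + y)) = 0 by exact: fZ.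
  have -> : f (x - y) = c ord0.
    by move: fy; rewrite !scalar_formB // scalar_formD // scalar_formZ // fv; lra.
  by move: h; rewrite opprD addrA addrAC.
have Fv i : F i v = 0 by apply: FZ; rewrite /Z' /= fv scale1r subrr; case: Zs => /set_mem.
have ZZ' z : Z z -> Z' z by move=> Zz; rewrite /Z' /= fZ // scale0r subr0.
exists n.+1, (fun i => oapp F f (unlift ord0 i)),
  (fun i => oapp c b (unlift ord0 i)),
  (fun i => oapp (fun j => e j - f (e j) *: v) v (unlift ord0 i)); split.
  by move=> i; case: unliftP => [j|] _ /=; split=> //; case: (Fs j).
split=> [i z Zz|i j|x].
- by case: unliftP => [j|] _ /=; [exact/FZ/ZZ'|exact: fZ].
- have Fsc k := (Fs k).1.
  case: (unliftP ord0 i) => [k|] ->; case: (unliftP ord0 j) => [l|] -> /=.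
  + by rewrite scalar_formB // scalar_formZ // Fv mulr0 subr0 Fe (inj_eq lift_inj).
  + by rewrite Fv.
  + by rewrite scalar_formB // scalar_formZ // fv mulr1 subrr.
  + exact: fv.
- rewrite big_ord_recl unlift_none /=.
  under eq_bigr do rewrite liftK /=.
  have := ZF x; rewrite /Z' /= scalar_formB // scalar_form_sum //.
  have -> : \sum_(i < n) F i x *: (e i - f (e i) *: v) =
      \sum_(i < n) F i x *: e i - (\sum_(i < n) F i x * f (e i)) *: v.
    by rewrite scaler_suml -sumrB; apply: eq_bigr => i _; rewrite scalerBr scalerA.
  by rewrite scalerBl; congr Z; rewrite [in RHS]addrCA [in RHS]opprD [RHS]addrA.
Qed.

End NormedForms.

Section FiniteCodim.
Context {R : realType} {V : normedModType R}.
Implicit Types (u : V -> R) (Z : set V).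

Lemma finite_codim_ker Z u : submod_closed [in Z] -> finite_codim Z ->
  scalar u -> finite_codim [set x | Z x /\ u x = 0].
Proof.
move=> Zs [e eP] us.
have [[v [Zv uv]]|no] := pselect (exists v, Z v /\ u v != 0); last first.
  exists e => x; have [c cP] := eP x; exists c; split=> //=.
  by apply/eqP; apply: contra_notT no => uv; eexists; split; [exact: cP|].
exists (v :: e) => x; have [c cP] := eP x.
set y := x - _ in cP.
exists (fun i => oapp c (u y / u v) (unlift ord0 i)).
rewrite big_ord_recl unlift_none /=.
under eq_bigr do rewrite liftK /=.
have -> : x - (u y / u v *: v + \sum_(i < size e) c i *: e`_i) = y - u y / u v *: v.
  by rewrite opprD addrA addrAC.
split; first by apply: (subspaceB Zs) => //; exact: (subspaceZ Zs).
by rewrite scalar_formB // scalar_formZ // divfK // subrr.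
Qed.

Lemma closed_finite_codim_kers m (u : 'I_m -> V -> R) (c : R) :
  (forall i, scalar (u i) /\ forall y, u i y <= c * `|y|) ->
  @closed_finite_codim_subspace R V [set x | forall i, u i x = 0].
Proof.
elim: m u => [|m IH] u uP.
  rewrite (_ : mkset _ = setT); last by apply/seteqP; split=> // x _ [].
  split; [|exact: closedT|].
    by split=> [|a x y _ _]; rewrite inE.
  by exists [::] => x; exists (fun=> 0).
have [Zs Zc Zf] := IH (fun i => u (lift ord0 i)) (fun i => uP (lift ord0 i)).
have -> : [set x | forall i, u i x = 0] =
    [set x | [set x | forall i, u (lift ord0 i) x = 0] x /\ u ord0 x = 0].
  apply/seteqP; split=> [x h|x [h1 h2] i]; first by split=> [i|]; exact: h.
  by case: (unliftP ord0 i) => [j|] ->; [exact: h1|].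
have [us ub] := uP ord0; split.
- split; first by rewrite inE; split=> [i|]; apply: scalar_form0 => //; case: (uP (lift ord0 i)).
  move=> a x y; rewrite !inE => -[xi x0] [yi y0]; split=> [i|].
    by case: (uP (lift ord0 i)) => vs _; rewrite vs xi yi mulr0 addr0.
  by rewrite us x0 y0 mulr0 addr0.
- apply: closedI => //.
  apply: (@closed_comp _ _ (u ord0) [set 0]) => [x _|]; last exact: closed_eq.
  exact: scalar_form_continuous us ub x.
- exact: finite_codim_ker.
Qed.

End FiniteCodim.

(** * Weak* compactness of the dual ball *)

HB.instance Definition _ (R : realType) (V : choiceType) :=
  isPointed.Build {ptws V -> R} (fun=> 0).

Section DualBall.
Context {R : realType} {V : normedModType R}.
Implicit Types (f g u : V -> R).

Definition dual_ball : set (V -> R) :=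
  [set u | scalar u /\ forall y, u y <= `|y|].

(** The Banach-Alaoglu theorem for covers by basic weak* neighbourhoods, whose test vectors may
    depend on the centre. *)
Lemma dual_ball_finite_cover (E : (V -> R) -> seq V) :
  exists (m : nat) (us : 'I_m -> V -> R), (forall i, dual_ball (us i)) /\
    forall u, dual_ball u ->
      exists i, forall y, y \in E (us i) -> `|u y - us i y| < 1.
Proof.
pose T := {ptws V -> R}.
pose P : set T := [set f | forall y, f y \in `[- `|y|, `|y|]].
have cP : compact P.
  exact: (@tychonoff V (fun=> R) (fun y => `[- `|y|, `|y|]%classic)
            (fun y => @segment_compact R (- `|y|) `|y|)).
have evc y : continuous (fun f : T => f y) by exact: proj_continuous.
pose good f := `[< scalar f >].
(* A nonlinear [f] receives the open complement of the linear functionals, so that the whole product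
   of intervals, to which Tychonoff's theorem applies, is covered. *)
pose N (f : T) : set T := if good f
  then [set g | forall y, y \in E f -> `|g y - f y| < 1]
  else [set g | ~ scalar g].
have openN f : open (N f).
  rewrite /N; case: ifP => _.
    elim: (E f) => [|y s IH].
      by rewrite (_ : mkset _ = setT); [exact: openT|apply/seteqP; split].
    rewrite (_ : mkset _ = (fun g : T => g y) @^-1` (ball (f y) 1) `&`
        [set g | forall y, y \in s -> `|g y - f y| < 1]).
      apply: openI => //; apply: open_comp => [g _|]; [exact: evc|exact: ball_open].
    apply/seteqP; split=> [g h|g [h1 h2] z].
      split; first by rewrite /= -ball_normE /= distrC h ?mem_head.
      by move=> z zs; apply: h; rewrite inE zs orbT.
    rewrite inE => /predU1P[->|/h2 //].
    by move: h1; rewrite /= -ball_normE /= distrC.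
  pose D a x y (g : T) : R := g (a *: x + y) - (a * g x + g y).
  have Dc a x y : continuous (D a x y).
    move=> g; have cD : (a * h x + h y) @[h --> g] --> a * g x + g y.
      have cM : (a * h x) @[h --> g] --> a * g x.
        exact: (cvgM (cvg_cst a) (evc x g)).
      exact: (@cvgD R R^o T (nbhs g) _ (fun h : T => a * h x)
        (fun h : T => h y) _ _ cM (evc y g)).
    exact: (@cvgB R R^o T (nbhs g) _ (fun h : T => h (a *: x + y))
      (fun h : T => a * h x + h y) _ _ (evc _ g) cD).
  rewrite (_ : mkset _ = \bigcup_(q in [set: R * V * V])
      (D q.1.1 q.1.2 q.2) @^-1` [set r : R | r != 0]).
    apply: bigcup_open => -[[a x] y] _; apply: open_comp; last exact: open_neq.
    by move=> g _; exact: Dc.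
  apply/seteqP; split=> [g /existsNP[a] /existsNP[x] /existsNP[y] h|].
    by exists (a, x, y) => //=; rewrite /D subr_eq0; exact/eqP.
  by move=> g [[[a x] y] _] /=; rewrite /D subr_eq0 => /eqP h gs; apply: h; rewrite gs.
have self f : P f -> N f f.
  move=> _; rewrite /N; case: ifP => [_ y _|/negbT/asboolPn //].
  by rewrite subrr normr0.
have {}cP : @cover_compact T P by rewrite -compact_cover.
have [//|f Pf|D DP Dcov] := cP T P N.
  by exists f => //; exact: self.
pose s := [seq f <- finmap.enum_fset D | good f].
exists (size s), (fun i => nth (fun=> 0) s i); split=> [i|u [us ub]].
  have : nth (fun=> 0) s i \in s by rewrite mem_nth.
  rewrite mem_filter => /andP[/asboolP gs /DP /set_mem Pi]; split=> // y.
  by have := Pi y; rewrite in_itv /= => /andP[].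
have [|f /= fD] := Dcov u.
  move=> y; rewrite in_itv /= -ler_norml.
  by rewrite -[leRHS]mul1r; apply: scalar_form_abs => // z; rewrite mul1r.
rewrite /N; case: ifP => // gf h.
have fs : f \in s by rewrite mem_filter gf.
have ifs : (index f s < size s)%N by rewrite index_mem.
by exists (Ordinal ifs); rewrite /= nth_index.
Qed.

End DualBall.

(** * The Gorelik principle for nets *)

Lemma continuous_sum_at (R : realType) (V W : normedModType R) m
    (h : 'I_m -> V -> W) q :
  (forall i, {for q, continuous (h i)}) ->
  {for q, continuous (fun x => \sum_i h i x)}.
Proof.
move=> hc; have addc : continuous (fun x : W * W => x.1 + x.2).
  exact: add_continuous.
exact: (@cvg_big W 'I_m +%R 0 xpredT addc V (nbhs q) (index_enum _) h
  (fun i => h i q) _ (fun i _ => hc i)).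
Qed.

Lemma addr_telescope3 (V : zmodType) (a b c d : V) :
  a = a - b + (b - c + d) + (c - d).
Proof. by rewrite !addrA subrK (addrAC _ d) subrK addrK. Qed.

Record lipschitz_nets (R : realType) (X Y : normedModType R) (M : set X)
    (L : set Y) (f : X -> Y) (g : Y -> X) (Lam beta : R) : Prop := {
  nets_Lam_ge1 : 1 <= Lam;
  nets_beta_gt0 : 0 < beta;
  netsX : forall x, exists2 z, M z & `|x - z| < beta;
  netsY : forall y, exists2 z, L z & `|y - z| < beta;
  nets_fML : forall x, M x -> L (f x);
  nets_gLM : forall y, L y -> M (g y);
  nets_fK : forall x, M x -> g (f x) = x;
  nets_gK : forall y, L y -> f (g y) = y;
  nets_f_lip : forall x x', M x -> M x' -> `|f x - f x'| <= Lam * `|x - x'|;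
  nets_g_lip : forall y y', L y -> L y' -> `|g y - g y'| <= Lam * `|y - y'| }.

Section Gorelik.
Context {R : realType} {X Y : normedModType R}.
Variables (M : set X) (L : set Y) (f : X -> Y) (g : Y -> X) (Lam beta : R).
Hypothesis nets : lipschitz_nets M L f g Lam beta.

(** Independent of [b], hence negligible at large scales. It dominates the spread of the points
    [z j] active at the approximate zero, and the part of the bound on [w] that is free of [b]. *)
Definition gorelik_const : R := 10 * Lam ^+ 2 * (beta + 1).

Let gorelik_const_ge :
  Lam * (2 * beta + Lam * (2 * beta + 2)) + 1 <= gorelik_const /\
  2 * Lam * beta + 2 * beta + 7 <= gorelik_const.
Proof.
case: nets => Lam1 beta0 _ _ _ _ _ _ _ _.
have Lam2 : Lam <= Lam ^+ 2 by rewrite expr2 ler_peMl //; lra.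
have Lam2b : Lam * beta <= Lam ^+ 2 * beta by rewrite ler_wpM2r // ltW.
have betaL : beta <= Lam * beta by rewrite ler_peMl // ltW.
by rewrite /gorelik_const; split; lra.
Qed.

(* A point [q] of X/X0, with its quasi-optimal lift [S q], is sent to the class of
   [g (f (m + S q) + y) - m], made continuous by a partition of unity.  As [g] is
   Lipschitz this stays at bounded distance from [q], so on a large cube it has an
   approximate zero, which yields [z] close to [m + X0]. *)
Lemma gorelik (b : R) (m : X) (X0 : set X) : 0 <= b ->
  @closed_finite_codim_subspace R X X0 ->
  exists F : seq Y, forall y, `|y| <= b -> exists z w s,
    [/\ M z, X0 w & s \in F] /\
    [/\ `|w| <= 2 * Lam * b + gorelik_const, `|z - m - w| <= gorelik_const &
        `|f z - s - y| <= beta].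
Proof.
case: nets => Lam1 beta0 M_net L_net fML gLM fK gK f_lip g_lip b0 X0P.
have [X0s X0c _] := X0P.
have [n [F [c [e [Fs [F0 Fe FX0]]]]]] := finite_codim_coords X0P.
have Fsc k := (Fs k).1.
have Fb k x : `|F k x| <= `|c k| * `|x|.
  apply: scalar_form_abs => // y; apply: le_trans ((Fs k).2 y) _.
  by rewrite ler_wpM2r // ler_norm.
pose E (q : 'rV[R]_n) : X := \sum_k q 0 k *: e k.
pose cE : R := \sum_k `|e k|.
have cE0 : 0 <= cE by apply: sumr_ge0.
pose d1 : R := (cE + 1)^-1.
have d10 : 0 < d1 by rewrite invr_gt0; lra.
have d11 : d1 <= 1 by rewrite invf_le1; lra.
have d1E : d1 * cE <= 1 by rewrite ler_pdivrMl; lra.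
have sumE (a : 'I_n -> R) : (forall k, `|a k| <= d1) -> `|\sum_k a k *: e k| <= 1.
  move=> ad; apply: le_trans d1E; apply: le_trans (ler_norm_sum _ _ _) _.
  by rewrite mulr_sumr; apply: ler_sum => k _; rewrite normrZ ler_wpM2r.
have EB q q' : E q - E q' = \sum_k (q 0 k - q' 0 k) *: e k.
  by rewrite -sumrB; apply: eq_bigr => k _; rewrite scalerBl.
have FE k q : F k (E q) = q 0 k.
  rewrite scalar_form_sum // (bigD1 k) //= Fe eqxx mulr1 big1 ?addr0 // => i ik.
  by rewrite Fe eq_sym (negPf ik) mulr0.
pose rho := Lam * (b + beta) + beta.
have Lam0 : 0 <= Lam by lra.
have bbeta0 : 0 <= b + beta by lra.
have rho0 : 0 <= rho by rewrite addr_ge0 ?mulr_ge0 // ltW.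
(* On a face of this cube the displacement, at most [rho + 1], and the error [d1] of the lift
   together cannot change the sign of the coordinate defining the face. *)
pose T : R := (\sum_k `|c k|) * (rho + 1) + 2.
have T0 : 0 < T.
  by rewrite ltr_wpDl // mulr_ge0 ?sumr_ge0 //; lra.
pose Q := [set v : 'rV[R]_n | forall i, `|v 0 i| <= T].
have cQ : compact Q := @rV_cube_compact R n T.
have [m1 [a [p1 [_ p1P]]]] := partition_of_unity cQ d10.
have [|zz zzP] := @fin_all_exists _ _
    (fun i z => X0 z /\ `|E (a i) - z| < dist_to X0 (E (a i)) + 1).
  by move=> i; have [z Zz h] := dist_to_approx X0s (E (a i)) ltr01; exists z.
pose sa i := E (a i) - zz i.
(* Quasi-optimal lifts need not depend continuously on the class; averaging those at nearby points
   [a i] costs a constant in norm and [d1] in each coordinate. *)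
pose S q := \sum_i p1 i q *: sa i.
have FS q k : Q q -> `|F k (S q) - q 0 k| <= d1.
  move=> /p1P[p10 p11 p1d _]; rewrite scalar_form_sum //.
  apply: (@convex_sum_close R R^o) => // i /p1d /ltW ad; apply: le_trans ad.
  rewrite /sa (scalar_formB _ _ (Fsc k)) FE F0 ?subr0; last by case: (zzP i).
  by rewrite distrC; have := rV_norm_ge (q - a i) k; rewrite !mxE.
have S_dist q : Q q -> `|S q| <= dist_to X0 (E q) + 2.
  move=> /p1P[p10 p11 p1d _]; rewrite -[S q]subr0.
  apply: convex_sum_close => // i /p1d ad; rewrite subr0.
  have [_ /ltW h] := zzP i; apply: le_trans h _.
  have : dist_to X0 (E (a i)) <= dist_to X0 (E (a i) - E q) + dist_to X0 (E q).
    by have [dD _] := dist_to_sublinear X0s; rewrite -{1}(subrK (E q) (E (a i))).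
  suff : dist_to X0 (E (a i) - E q) <= 1 by lra.
  apply: le_trans (dist_to_norm X0s _) _; rewrite EB; apply: sumE => k.
  apply: le_trans (ltW ad); rewrite distrC.
  by have := rV_norm_ge (q - a i) k; rewrite !mxE.
have S_cont q : Q q -> {for q, continuous S}.
  move=> /p1P[_ _ _ pc]; apply: continuous_sum_at => i.
  by apply: continuousZ; [exact: pc|exact: cst_continuous].
have [d2 [d20 d2P]] : exists d : R, 0 < d /\
    forall x y, Q x -> Q y -> `|x - y| < d -> `|S x - S y| < 1.
  near (0:R)^'+ => d; exists d; split; first by near: d; exact: nbhs_right_gt.
  by near: d; apply: compact_unif_cont.
have [m2 [bb [p2 [bbQ p2P]]]] := partition_of_unity cQ d20.
have [|sg sgP] := @fin_all_exists _ _
    (fun j s => M s /\ `|m + S (bb j) - s| < beta).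
  by move=> j; have [z Mz h] := M_net (m + S (bb j)); exists z.
(* The list precedes [y]: a weak* neighbourhood will be made from it, while [y] will depend on the
   functional [v] of that neighbourhood. *)
exists [seq f (sg j) | j <- enum 'I_m2] => y yb.
have [|l lP] := @fin_all_exists _ _
    (fun j l => L l /\ `|f (sg j) + y - l| < beta).
  by move=> j; have [z Lz h] := L_net (f (sg j) + y); exists z.
pose z j := g (l j).
have z_S j : `|z j - m - S (bb j)| <= rho.
  have [Ms hs] := sgP j; have [Ll hl] := lP j.
  have : `|z j - sg j| <= Lam * (b + beta).
    have := g_lip _ _ Ll (fML _ Ms); rewrite (fK _ Ms) => h; apply: le_trans h _.
    rewrite ler_wpM2l ?(le_trans ler01) //.
    apply: le_trans (ler_distD (f (sg j) + y) _ _) _.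
    by rewrite [in X in _ + X]addrAC subrr add0r distrC; lra.
  have -> : z j - m - S (bb j) = z j - sg j + (sg j - (m + S (bb j))).
    by rewrite addrA subrK opprD addrA.
  move: hs; rewrite distrC /rho.
  by have := ler_normD (z j - sg j) (sg j - (m + S (bb j))); lra.
pose Zq q := \sum_j p2 j q *: (z j - m).
have Z_S q : Q q -> `|Zq q - S q| <= rho + 1.
  move=> Qq; have [p20 p21 p2d _] := p2P _ Qq.
  apply: convex_sum_close => // j /p2d qb.
  apply: le_trans (ler_distD (S (bb j)) _ _) _.
  have h1 := z_S j; have h2 := d2P _ _ Qq (bbQ j) qb.
  by rewrite distrC in h2; lra.
have FZ_q k q : Q q -> `|F k (Zq q) - q 0 k| <= T.
  move=> Qq; apply: le_trans (ler_distD (F k (S q)) _ _) _.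
  rewrite -(scalar_formB _ _ (Fsc k)); have := Fb k (Zq q - S q); have := FS q k Qq.
  have : `|c k| * `|Zq q - S q| <= (\sum_k `|c k|) * (rho + 1).
    rewrite ler_pM ?Z_S // (bigD1 k) //= lerDl; exact: sumr_ge0.
  rewrite /T; lra.
have [|||q Qq Fq] := @approx_poincare_miranda R n (fun k q => F k (Zq q)) T d1 T0 d10.
- move=> k q /p2P[_ _ _ pc].
  have -> : (fun q => F k (Zq q)) = fun q => \sum_j p2 j q * F k (z j - m).
    by apply/funext => q'; rewrite scalar_form_sum.
  apply: (@continuous_sum_at R _ R^o) => j.
  by apply: continuousM; [exact: pc|exact: cst_continuous].
- by move=> k q Qq qT; have := FZ_q k q Qq; rewrite qT ler_norml; lra.
- by move=> k q Qq qT; have := FZ_q k q Qq; rewrite qT ler_norml; lra.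
pose w := Zq q - \sum_k F k (Zq q) *: e k.
have X0w : X0 w by exact: FX0.
have Zw : `|Zq q - w| <= 1 by rewrite opprB addrC subrK; exact: sumE.
have Zqb := Z_S q Qq.
(* [S q] is within [rho + 2] of [X0], so the class of [E q] is short, and so is its quasi-optimal
   lift [S q]. This bounds [w] independently of the size of the cube. *)
have dEq : dist_to X0 (E q) <= rho + 3.
  pose q' := \row_k F k (S q).
  have -> : E q = E q - E q' + (E q' - S q + w) + (S q - w).
    exact: addr_telescope3.
  have X0u : X0 (E q' - S q + w).
    apply: (subspaceD X0s) => //; rewrite -opprB -scaleN1r; apply: (subspaceZ X0s).
    by rewrite /E; under eq_bigr do rewrite mxE; exact: FX0.
  apply: le_trans (dist_to_le X0s _ X0u) _.
  rewrite addrAC addrK.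
  have h1 : `|E q - E q'| <= 1.
    by rewrite EB; apply: sumE => k; rewrite mxE distrC; exact: FS.
  have h2 := ler_distD (Zq q) (S q) w; rewrite distrC in Zqb.
  have := ler_normD (E q - E q') (S q - w); lra.
have Sq := S_dist q Qq.
have wb : `|w| <= 2 * rho + 7.
  have := ler_normB (Zq q) (Zq q - w); rewrite subKr.
  have := ler_normD (Zq q - S q) (S q); rewrite subrK.
  lra.
have [p20 p21 p2d _] := p2P _ Qq.
(* Any active index will do: [f] and [g] being Lipschitz, all active [z j] are close to each
   other. *)
have [j0 pj0] : exists j, p2 j q != 0.
  apply/existsP; apply: contra_eqT p21; rewrite negb_exists => /forallP h.
  rewrite big1 ?(eq_sym 0) ?oner_eq0 // => j _; apply/eqP.
  by have := h j; rewrite negbK.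
have z_near : `|Zq q - (z j0 - m)| <= Lam * (2 * beta + Lam * (2 * beta + 2)).
  apply: convex_sum_close => // j pj.
  have -> : z j - m - (z j0 - m) = z j - z j0 by rewrite opprB addrA subrK.
  have [Ms hs] := sgP j; have [Ms0 hs0] := sgP j0.
  have [Ll hl] := lP j; have [Ll0 hl0] := lP j0.
  apply: le_trans (g_lip _ _ Ll Ll0) _; rewrite ler_wpM2l ?(le_trans ler01) //.
  have h1 := ler_distD (f (sg j) + y) (l j) (l j0).
  have h2 := ler_distD (f (sg j0) + y) (f (sg j) + y) (l j0).
  have h3 : `|f (sg j) - f (sg j0)| <= Lam * (2 * beta + 2).
    apply: le_trans (f_lip _ _ Ms Ms0) _; rewrite ler_wpM2l ?(le_trans ler01) //.
    have k1 := ler_distD (m + S (bb j)) (sg j) (sg j0).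
    have k2 := ler_distD (m + S (bb j0)) (m + S (bb j)) (sg j0).
    have k3 := ler_distD (S q) (S (bb j)) (S (bb j0)).
    have k4 := d2P _ _ Qq (bbQ j) (p2d _ pj).
    have k5 := d2P _ _ Qq (bbQ j0) (p2d _ pj0).
    rewrite opprD addrACA subrr add0r in k2.
    rewrite [`|sg j - (_ + _)|]distrC in k1; rewrite [`|S (bb j) - S q|]distrC in k3.
    lra.
  rewrite opprD addrACA subrr addr0 in h2.
  rewrite [`|l j - (_ + _)|]distrC in h1.
  lra.
have [kap1 kap2] := gorelik_const_ge.
exists (z j0), w, (f (sg j0)); split; split=> //.
- by apply: gLM; case: (lP j0).
- by rewrite map_f // mem_enum.
- by apply: le_trans wb _; rewrite /rho; lra.
- have := ler_distD (Zq q) (z j0 - m) w; rewrite [`|z j0 - m - Zq q|]distrC.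
  move=> /le_trans; apply; apply: le_trans kap1; exact: lerD.
- have [Ll hl] := lP j0.
  by rewrite /z gK // -addrA -opprD distrC ltW.
Unshelve. all: by end_near. Qed.

End Gorelik.

(** * Asymptotic Lipschitz constants of functionals *)

Section Gauge.
Context {R : realType} {Y : normedModType R}.
Implicit Types (u v : Y -> R) (A : set Y) (C e : R) (E : seq Y).

(** Basic weak* neighbourhoods; an error [e] in place of 1 is obtained by testing on [e^-1 *: y]. *)
Definition close_on E u v := forall y, y \in E -> `|u y - v y| < 1.

Lemma close_on_cat E E' u v :
  close_on (E ++ E') u v <-> close_on E u v /\ close_on E' u v.
Proof.
split=> [h|[h1 h2] y]; last by rewrite mem_cat => /orP[/h1|/h2].
by split=> y yE; apply: h; rewrite mem_cat yE ?orbT.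
Qed.

(* The last condition is lower semicontinuity for the weak* topology. *)
Definition lsc_gauge C (phi : (Y -> R) -> R) :=
  [/\ forall u, dual_ball u -> 0 <= phi u <= C,
      forall u (c : R), dual_ball u -> dual_ball (fun y => c * u y) ->
        phi (fun y => c * u y) <= `|c| * phi u &
      forall u e, dual_ball u -> 0 < e -> exists E, forall v, dual_ball v ->
        close_on E v u -> phi u - e <= phi v].

Definition support_fun A u := sup [set u a | a in A].

Lemma dual_ball_abs u y : dual_ball u -> `|u y| <= `|y|.
Proof.
by case=> us ub; rewrite -[leRHS]mul1r; apply: scalar_form_abs => // z; rewrite mul1r.
Qed.

Section SupportFun.
Variables (A : set Y) (C : R).
Hypothesis A0 : A !=set0.
Hypothesis AN : forall a, A a -> A (- a).
Hypothesis AC : forall a, A a -> `|a| <= C.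

Lemma support_has_sup u : dual_ball u -> has_sup [set u a | a in A].
Proof.
move=> [us ub]; split; first by have [a Aa] := A0; exists (u a), a.
by exists C => _ [a Aa <-]; apply: le_trans (ub a) (AC Aa).
Qed.

Lemma support_ge u a : dual_ball u -> A a -> u a <= support_fun A u.
Proof.
by move=> ub Aa; apply: ub_le_sup; [case: (support_has_sup ub)|exists a].
Qed.

Lemma support_le u c : (forall a, A a -> u a <= c) -> support_fun A u <= c.
Proof.
move=> h; apply: ge_sup; first by have [a Aa] := A0; exists (u a), a.
by move=> _ [a Aa <-]; exact: h.
Qed.

Lemma support_ge0 u : dual_ball u -> 0 <= support_fun A u.
Proof.
move=> ub; have [a Aa] := A0.
have h1 := support_ge ub Aa; have h2 := support_ge ub (AN Aa).
by move: h2; rewrite scalar_formN; [lra|case: ub].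
Qed.

Lemma support_approx u e : dual_ball u -> 0 < e ->
  exists2 a, A a & support_fun A u - e < u a.
Proof.
by move=> ub e0; have [_ [a Aa <-] h] := sup_adherent e0 (support_has_sup ub); exists a.
Qed.

Lemma support_gauge : lsc_gauge C (support_fun A).
Proof.
split=> [u ub|u c ub _|u e ub e0].
- rewrite support_ge0 //=; apply: support_le => a Aa.
  by apply: le_trans (AC Aa); case: ub.
- apply: support_le => a Aa; have [c0|c0] := leP 0 c.
    by rewrite ger0_norm // ler_wpM2l // support_ge.
  have [us _] := ub; rewrite ltr0_norm // -mulrNN -(scalar_formN _ us).
  by rewrite ler_wpM2l ?support_ge ?oppr_ge0 ?ltW //; exact: AN.
have e20 : 0 < e / 2 by rewrite divr_gt0.
have [a Aa ha] := support_approx ub e20.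
exists [:: (e / 2)^-1 *: a] => v vb /(_ _ (mem_head _ _)).
have [[us _] [vs _]] := (ub, vb).
rewrite (scalar_formZ _ _ us) (scalar_formZ _ _ vs) -mulrBr normrM.
rewrite gtr0_norm ?invr_gt0 //.
rewrite ltr_pdivrMl // mulr1 ltr_norml => /andP[h _].
by have := support_ge vb Aa; lra.
Qed.

End SupportFun.

Lemma lsc_gauge_avg C n (phi : nat -> (Y -> R) -> R) :
  (forall i, lsc_gauge C (phi i)) ->
  lsc_gauge C (fun u => n.+1%:R^-1 * \sum_(i < n.+1) phi i u).
Proof.
move=> phiC; have n0 : 0 < n.+1%:R :> R by rewrite ltr0n.
have avg (c : R) : c = n.+1%:R^-1 * \sum_(i < n.+1) c.
  by rewrite sumr_const card_ord -[c *+ _]mulr_natl mulKf // gt_eqF.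
have i0 : 0 <= n.+1%:R^-1 :> R by rewrite invr_ge0 ltW.
split=> [u ub|u c ub cub|u e ub e0].
- rewrite mulr_ge0 //=; last first.
    by apply: sumr_ge0 => i _; case: (phiC i) => /(_ u ub) /andP[].
  rewrite [leRHS]avg ler_wpM2l //; apply: ler_sum => i _.
  by case: (phiC i) => /(_ u ub) /andP[].
- rewrite mulrCA ler_wpM2l // mulr_sumr; apply: ler_sum => i _.
  by case: (phiC i) => _ h _; exact: h.
have /fin_all_exists[E EP] : forall i : 'I_n.+1, exists E, forall v, dual_ball v ->
    close_on E v u -> phi i u - e <= phi i v.
  by move=> i; case: (phiC i) => _ _ h; exact: h.
exists (flatten [seq E i | i <- enum 'I_n.+1]) => v vb vE.
rewrite {1}[e]avg -mulrBr -sumrB ler_wpM2l //; apply: ler_sum => i _.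
apply: EP => // y yE; apply: vE; apply/flattenP; exists (E i) => //.
by rewrite map_f // mem_enum.
Qed.

End Gauge.

Lemma exp8_large (R : realType) (B : R) : exists k0, forall k, (k0 <= k)%N -> B <= 8 ^+ k.
Proof.
exists (Num.truncn B).+1 => k kB; apply: le_trans (ltW (truncnS_gt B)) _.
by rewrite -natrX ler_nat; apply: leq_trans kB _; exact/ltnW/ltn_expl.
Qed.

Section ZmodIdentities.
Context {V : zmodType}.
Implicit Types a m w z : V.

(** In these identities [m] is a midpoint, [m + a] and [m - a] are the end points, and [z - m - w]
    is the error in the Gorelik principle. *)
Lemma addr_split1 a m w z : m + a - z = (a - w) - (z - m - w).
Proof. by rewrite opprB addrA subrK opprB addrA [a + m]addrC. Qed.
Lemma addr_split2 a m w z : z - (m - a) = (a + w) + (z - m - w).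
Proof. by rewrite [RHS]addrC addrA (addrAC _ (- w)) subrK opprB addrA addrAC. Qed.
Lemma addr_split3 a m w z : a = (m + a - z) + (z - m - w) + w.
Proof. by rewrite !addrA subrK subrK addrAC subrr add0r. Qed.
Lemma addr_split4 a m w z : a = (z - (m - a)) - (z - m - w) - w.
Proof.
by rewrite (opprB (z - m)) addrA (addrAC _ _ (- w)) addrK !opprB !addrA subrK addrAC subrr add0r.
Qed.
End ZmodIdentities.

(** * Growth of the large-scale Lipschitz constants under weak* perturbations *)

Section Gain.
Context {R : realType} {X Y : normedModType R}.
Variables (M : set X) (L : set Y) (f : X -> Y) (g : Y -> X) (Lam beta : R).
Hypothesis nets : lipschitz_nets M L f g Lam beta.
Hypothesis X_nontrivial : exists x : X, x != 0.

(** The ratio 8 leaves room for cutting a pair at distance at least [8 ^+ k.+1] near its midpoint: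
    both pieces have length at least [8 ^+ k], even after the deviation [w] and the Gorelik
    error. *)
Definition quotients k : set Y :=
  [set a | exists x x', [/\ M x, M x', 8 ^+ k <= `|x - x'| &
    a = `|x - x'|^-1 *: (f x - f x')]].

Let exp8_gt0 k : 0 < 8 ^+ k :> R. Proof. by rewrite exprn_gt0. Qed.

Lemma quotients_neq0 k : quotients k !=set0.
Proof.
have [x0 x00] := X_nontrivial; case: nets => _ beta0 M_net _ _ _ _ _ _ _.
pose c := (8 ^+ k + 2 * beta) / `|x0|; pose x := c *: x0.
have [z Mz hz] := M_net x; have [z' Mz' hz'] := M_net 0.
exists (`|z - z'|^-1 *: (f z - f z')), z, z'; split=> //.
have xn : `|x| = 8 ^+ k + 2 * beta.
  have := exp8_gt0 k.
  rewrite normrZ /c normrM normfV normr_id divfK ?normr_eq0 // => h.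
  by rewrite ger0_norm //; lra.
rewrite sub0r normrN in hz'.
have := ler_normD (x - z) (z - z' + z'); rewrite subrK addrNK.
have := ler_normD (z - z') z'; rewrite subrK; have := ler_normD (x - z) z; rewrite subrK.
lra.
Qed.

Lemma quotientsN k a : quotients k a -> quotients k (- a).
Proof.
move=> [x [x' [Mx Mx' h ->]]]; exists x', x; split=> //; first by rewrite distrC.
by rewrite -scalerN opprB distrC.
Qed.

Lemma quotients_le k a : quotients k a -> `|a| <= Lam.
Proof.
move=> [x [x' [Mx Mx' h ->]]]; have h0 := lt_le_trans (exp8_gt0 k) h.
rewrite normrZ normfV normr_id ler_pdivrMl // mulrC.
by case: nets => _ _ _ _ _ _ _ _ lf _; exact: lf.
Qed.

Definition large_lip k := support_fun (quotients k).

Lemma large_lip_gauge k : lsc_gauge Lam (large_lip k).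
Proof.
exact: support_gauge (quotients_neq0 k) (@quotientsN k) (@quotients_le k).
Qed.

Lemma large_lip_ge k u x x' : dual_ball u -> M x -> M x' -> 8 ^+ k <= `|x - x'| ->
  u (f x) - u (f x') <= large_lip k u * `|x - x'|.
Proof.
move=> ub Mx Mx' h; have h0 := lt_le_trans (exp8_gt0 k) h.
have us : scalar u by case: ub.
have Q : quotients k (`|x - x'|^-1 *: (f x - f x')) by exists x, x'.
have := support_ge (quotients_neq0 k) (@quotients_le k) ub Q.
by rewrite scalar_formZ // ler_pdivrMl // scalar_formB // mulrC.
Qed.

Local Notation kap := (gorelik_const Lam beta).

Section OneScale.
Variables (tau r : R).
Hypotheses (tau_gt0 : 0 < tau) (r_gt0 : 0 < r) (r_le : r <= 1 / 2).
Hypothesis X_smooth : forall x : X, `|x| = 1 ->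
  exists2 X0, @closed_finite_codim_subspace R X X0 &
    forall w, X0 w -> `|w| <= r -> `|x + w| <= 1 + tau * r / (32 * Lam ^+ 2).

(* Take [x], [x'] nearly optimal for [u] and let [z] be the point given by the
   Gorelik principle around their midpoint, for a [y] on which [v - u] is large
   and negative.  By asymptotic smoothness [z] is almost a metric midpoint, and
   estimating [v] between [z] and [x], and [u] between [x'] and [z], the term
   [(v - u) y] is gained. *)
Lemma gain_large_lip : exists k0, forall k, (k0 <= k)%N ->
  forall u, dual_ball u -> exists E, forall v, dual_ball v -> close_on E v u ->
    (exists y, tau * `|y| < v y - u y) ->
    2 * large_lip k.+1 u + tau * r / (16 * Lam) <= large_lip k v + large_lip k u.
Proof.
have [Lam1 beta0 _ _ _ _ _ _ _ _] := nets.
have [[tau0 r0] r1] := (tau_gt0, r_gt0, r_le).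
have Lam0 : 0 < Lam by lra.
have kap0 : 0 < kap by rewrite !mulr_gt0 ?exprn_gt0 //; lra.
(* [c1] collects the errors that do not grow with the distance [2 * h] of the pair, whereas the gain
   contains [h * g1 / 2]. A large [k] makes [c1] at most a quarter of that. *)
pose c1 := 2 * Lam * kap + tau * (kap / (2 * Lam)) + 2 + 2 * beta.
pose g1 := tau * r / Lam.
have g10 : 0 < g1 by rewrite divr_gt0 ?mulr_gt0.
have c10 : 0 < c1.
  have h1 : 0 < tau * (kap / (2 * Lam)) by rewrite mulr_gt0 // divr_gt0 // mulr_gt0.
  have h2 : 0 < 2 * Lam * kap by rewrite mulr_gt0 // mulr_gt0.
  rewrite /c1; lra.
have [k0 k0P] := exp8_large (kap + kap / r + c1 * (8 / g1)).
exists k0 => k /k0P kP u ub.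
have kr0 : 0 < kap / r by rewrite divr_gt0.
have cg0 : 0 < c1 * (8 / g1) by rewrite mulr_gt0 // divr_gt0.
have us : scalar u by case: ub.
have [|a [x [x' [Mx Mx' hD aE]]] ha] := @support_approx _ _ _ _ (quotients_neq0 k.+1)
   (@quotients_le k.+1) u (g1 / 64) ub.
  by rewrite divr_gt0.
set D := `|x - x'| in hD aE; pose h := D / 2.
have h8 : 4 * 8 ^+ k <= h by rewrite /h; move: hD; rewrite exprS; lra.
have D0 : 0 < D by apply: lt_le_trans hD; exact: exp8_gt0.
have h0 : 0 < h by rewrite divr_gt0.
pose m0 := 2^-1 *: (x + x'); pose v0 := D^-1 *: (x - x').
have v01 : `|v0| = 1 by rewrite normrZ normfV normr_id -/D mulVf // gt_eqF.
have hv0 : h *: v0 = 2^-1 *: (x - x').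
  by rewrite scalerA /h mulrAC divff ?gt_eqF // mul1r.
have half (p : X) : 2^-1 *: (p + p) = p.
  rewrite scalerDr -scalerDl; have -> : 2^-1 + 2^-1 = 1 :> R by lra.
  exact: scale1r.
have m0x : m0 + h *: v0 = x.
  by rewrite hv0 -scalerDr addrACA subrr addr0 half.
have m0x' : m0 - h *: v0 = x'.
  by rewrite hv0 -scalerBr opprB addrC addrA subrK half.
have [X0 X0P X0sm] := X_smooth v01; have [X0s _ _] := X0P.
(* The bound [2 * Lam * b + kap] on [w] becomes [r * h], the largest size at which smoothness
   applies after division by [h]. *)
pose b := (r * h - kap) / (2 * Lam).
have rh : kap <= r * h by rewrite mulrC -ler_pdivrMr //; lra.
have b0 : 0 <= b by rewrite divr_ge0 ?mulr_ge0 //; lra.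
have [F FP] := gorelik nets m0 b0 X0P.
exists (f x :: F) => v vb vE [y0 hy0].
have vs : scalar v by case: vb.
have y00 : 0 < `|y0|.
  rewrite normr_gt0; apply: contraTneq hy0 => ->.
  by rewrite normr0 mulr0 (scalar_form0 us) (scalar_form0 vs) subrr ltxx.
pose y := - (b / `|y0|) *: y0.
have yb : `|y| <= b by rewrite normrZ normrN normrM normfV normr_id divfK ?gt_eqF // ger0_norm.
have vy : v y - u y <= - (tau * b).
  rewrite (scalar_formZ _ _ us) (scalar_formZ _ _ vs) -mulrBr mulNr lerN2.
  rewrite [leLHS]mulrC -[leRHS]mulrA ler_wpM2l // ler_pdivlMl // mulrC.
  exact: ltW.
have [z [w [s [[Mz X0w Fs] [wb zw fz]]]]] := FP y yb.
have wr : `|w| <= r * h.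
  apply: le_trans wb _; rewrite /b mulrC divfK; last by rewrite gt_eqF // mulr_gt0.
  by rewrite subrK.
pose q := 1 + tau * r / (32 * Lam ^+ 2).
have sm (t : R) : `|t| = 1 -> `|h *: v0 + t *: w| <= h * q.
  move=> t1; have -> : h *: v0 + t *: w = h *: (v0 + (t / h) *: w).
    rewrite [RHS]scalerDr; congr (_ + _).
    by rewrite scalerA mulrC divfK // gt_eqF.
  rewrite normrZ gtr0_norm // ler_pM2l //; apply: X0sm.
    exact: (subspaceZ X0s).
  by rewrite normrZ normrM t1 mul1r normfV gtr0_norm // ler_pdivrMl // mulrC.
have zx : `|x - z| <= h * q + kap.
  have -> : x - z = (h *: v0 + (-1) *: w) - (z - m0 - w).
    by rewrite scaleN1r -addr_split1 m0x.
  apply: le_trans (ler_normB _ _) _; rewrite lerD // sm //.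
  by rewrite normrN normr1.
have zx' : `|z - x'| <= h * q + kap.
  have -> : z - x' = (h *: v0 + 1 *: w) + (z - m0 - w).
    by rewrite scale1r -addr_split2 m0x'.
  by apply: le_trans (ler_normD _ _) _; rewrite lerD // sm // normr1.
have DE : `|x - x'| = 2 * h by rewrite -/D /h mulrC divfK.
have wh : `|w| <= h / 2 by apply: le_trans wr _; rewrite mulrC ler_wpM2l ?(ltW h0) //; lra.
have hvn : `|h *: v0| = h by rewrite normrZ v01 mulr1 gtr0_norm.
have zx_ge : 8 ^+ k <= `|x - z|.
  have : h <= `|x - z| + `|z - m0 - w| + `|w|.
    rewrite -{1}hvn; have -> : h *: v0 = (x - z) + (z - m0 - w) + w.
      by rewrite -m0x -addr_split3.
    by apply: le_trans (ler_normD _ _) _; rewrite lerD2r ler_normD.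
  lra.
have zx'_ge : 8 ^+ k <= `|z - x'|.
  have : h <= `|z - x'| + `|z - m0 - w| + `|w|.
    rewrite -{1}hvn; have -> : h *: v0 = (z - x') - (z - m0 - w) - w.
      by rewrite -m0x' -addr_split4.
    by apply: le_trans (ler_normB _ _) _; rewrite lerD2r ler_normB.
  lra.
have H1 := large_lip_ge vb Mx Mz zx_ge.
have H2 := large_lip_ge ub Mz Mx' zx'_ge.
have [Lg _ _] := large_lip_gauge k.
have /andP[pv0 pv1] := Lg _ vb; have /andP[pu0 pu1] := Lg _ ub.
set pv := large_lip k v in H1 pv0 pv1 *; set pu := large_lip k u in H2 pu0 pu1 *.
have {}H1 : v (f x) - v (f z) <= pv * (h * q + kap).
  by apply: le_trans H1 _; rewrite ler_wpM2l.
have {}H2 : u (f z) - u (f x') <= pu * (h * q + kap).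
  by apply: le_trans H2 _; rewrite ler_wpM2l.
have H3 : u (f x) - u (f x') = 2 * h * u a.
  rewrite aE (scalar_formZ _ _ us) (scalar_formB _ _ us) -DE -/D mulrA divff ?mul1r //.
  by rewrite gt_eqF.
rewrite -/(large_lip _) in ha; set N := large_lip k.+1 u in ha *.
have H4 : 2 * h * (N - g1 / 64) <= 2 * h * u a.
  by rewrite ler_wpM2l; [|rewrite mulr_ge0 // ltW|exact: ltW].
have := vE _ (mem_head _ _); have : s \in f x :: F by rewrite inE Fs orbT.
move=> /vE; rewrite !ltr_norml => /andP[_ H5] /andP[H6 _].
have rho : `|v (f z - s - y)| <= beta by apply: le_trans (dual_ball_abs _ vb) fz.
have rho' : `|u (f z - s - y)| <= beta by apply: le_trans (dual_ball_abs _ ub) fz.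
rewrite !(scalar_formB _ _ vs) ler_norml in rho.
rewrite !(scalar_formB _ _ us) ler_norml in rho'.
have H7 : tau * b = tau * (h * r / (2 * Lam)) - tau * (kap / (2 * Lam)).
  by rewrite -mulrBr /b mulrBl [r * h]mulrC.
have H8 : tau * (h * r / (2 * Lam)) = h * (g1 / 2).
  by rewrite /g1 !invfM; lra.
have qE : q = 1 + g1 / (32 * Lam).
  by rewrite /q /g1 expr2 !invfM; lra.
have H9 : (pv + pu) * (h * q + kap) <= h * (pv + pu) + h * (g1 / 16) + 2 * Lam * kap.
  have -> : h * (g1 / 16) = 2 * Lam * (h * (g1 / (32 * Lam))).
    have -> : 2 * Lam * (h * (g1 / (32 * Lam))) = Lam / Lam * (h * (g1 / 16)).
      by rewrite invfM; lra.
    by rewrite divff ?mul1r // gt_eqF.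
  have h1 : (pv + pu) * (h * (g1 / (32 * Lam)) + kap) <=
      2 * Lam * (h * (g1 / (32 * Lam)) + kap).
    rewrite ler_wpM2r //; last by rewrite mulr_natl mulr2n; exact: lerD.
    by apply: ltW; rewrite addr_gt0 // mulr_gt0 // divr_gt0 // mulr_gt0.
  rewrite qE; lra.
have H10 : c1 <= h * (g1 / 8).
  have g8 : 0 < g1 / 8 by rewrite divr_gt0.
  have : c1 * (8 / g1) <= h by lra.
  by rewrite -(invf_div g1) ler_pdivrMr.
have H11 : h * (2 * N + g1 / 16) <= h * (pv + pu).
  have hg : 0 < h * g1 by rewrite mulr_gt0.
  rewrite /c1 in H10; lra.
have -> : tau * r / (16 * Lam) = g1 / 16 by rewrite /g1 invfM; lra.
by rewrite ler_pM2l in H11.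
Qed.

(* The shift of scale in [gain_large_lip] disappears in a long average. *)
Lemma gain_gauge : exists phi : (Y -> R) -> R, lsc_gauge Lam phi /\
  forall u, dual_ball u -> exists E, forall v, dual_ball v -> close_on E v u ->
    (exists y, tau * `|y| < v y - u y) ->
    phi u + tau * r / (64 * Lam) <= phi v.
Proof.
have Lam1 := nets_Lam_ge1 nets.
have [tau0 r0] := (tau_gt0, r_gt0); have Lam0 : 0 < Lam by lra.
have [k0 k0P] := gain_large_lip.
set G := tau * r / (16 * Lam) in k0P.
have G0 : 0 < G by rewrite divr_gt0 ?mulr_gt0.
(* Telescoping leaves a boundary term of at most [2 * Lam], which this [n] makes at most half of the
   accumulated gain. *)
pose n := Num.truncn (4 * Lam / G).
have nG : 4 * Lam <= n.+1%:R * G by rewrite -ler_pdivrMr // ltW // truncnS_gt.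
have n0 : 0 < n.+1%:R :> R by rewrite ltr0n.
exists (fun u => n.+1%:R^-1 * \sum_(i < n.+1) large_lip (k0 + i) u); split.
  by apply: (lsc_gauge_avg n (phi := fun i => large_lip (k0 + i))) => i; exact: large_lip_gauge.
move=> u ub.
have /fin_all_exists[E EP] : forall i : 'I_n.+1, exists E, forall v, dual_ball v ->
    close_on E v u -> (exists y, tau * `|y| < v y - u y) ->
    2 * large_lip (k0 + i).+1 u + G <= large_lip (k0 + i) v + large_lip (k0 + i) u.
  by move=> i; apply: k0P => //; exact: leq_addr.
exists (flatten [seq E i | i <- enum 'I_n.+1]) => v vb vE vu.
have H : \sum_(i < n.+1) (2 * large_lip (k0 + i).+1 u + G) <=
    \sum_(i < n.+1) (large_lip (k0 + i) v + large_lip (k0 + i) u).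
  apply: ler_sum => i _; apply: EP => // y yE; apply: vE.
  by apply/flattenP; exists (E i) => //; rewrite map_f // mem_enum.
rewrite !big_split /= -mulr_sumr sumr_const card_ord -[G *+ _]mulr_natl in H.
have tele : \sum_(i < n.+1) large_lip (k0 + i).+1 u =
    \sum_(i < n.+1) large_lip (k0 + i) u - large_lip k0 u + large_lip (k0 + n.+1) u.
  rewrite [in RHS]big_ord_recl addn0 [_ + \sum_(i < n) _]addrC addrK.
  rewrite big_ord_recr /= addnS; congr (_ + _).
  by apply: eq_bigr => i _; rewrite /bump /= add1n addnS.
have [Lg1 _ _] := large_lip_gauge k0; have /andP[_ a1] := Lg1 _ ub.
have [Lg2 _ _] := large_lip_gauge (k0 + n.+1); have /andP[a2 _] := Lg2 _ ub.
have -> : tau * r / (64 * Lam) = n.+1%:R^-1 * (n.+1%:R * (G / 4)).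
  rewrite mulKf ?gt_eqF // /G -[RHS]mulrA -invfM; congr (_ / _).
  by lra.
rewrite -mulrDr ler_wpM2l ?invr_ge0 ?ltW //.
by rewrite tele in H; lra.
Qed.

End OneScale.
End Gain.

(** * Estimates of the modulus of asymptotic smoothness *)

Section AsymSmooth.
Context {R : realType} {X : normedModType R}.
Implicit Types (N : X -> R) (t c : R) (x z : X) (Z : set X).

Lemma sup_ge0_of (S : set R) : (forall s, S s -> 0 <= s) -> 0 <= sup S.
Proof.
move=> S0; have [hs|/sup_out -> //] := pselect (has_sup S).
have [[s Ss] ub] := hs; apply: le_trans (S0 s Ss) _.
exact: ub_le_sup.
Qed.

Lemma setT_closed_finite_codim : @closed_finite_codim_subspace R X setT.
Proof.
split; [|exact: closedT|by exists [::] => x; exists (fun=> 0)].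
by split=> [|a x y _ _]; rewrite inE.
Qed.

Lemma asym_smooth_le N t c : 0 <= c -> (forall x, 0 <= N x) ->
  (forall x, N x = 1 -> exists2 Z, closed_finite_codim_subspace Z &
     forall z, Z z -> N z = 1 -> N (x + t *: z) <= 1 + c) ->
  asym_smooth N t <= c.
Proof.
move=> c0 N0 h; rewrite /asym_smooth; set S := (S in sup S).
have [[s Ss]|/forallNP S0] := pselect (exists s, S s); last first.
  suff -> : S = set0 by rewrite sup0.
  by apply/seteqP; split=> // s /S0.
apply: ge_sup; first by exists s.
move=> _ [x Nx <-]; have [Z Zc ZP] := h x Nx.
apply: (@le_trans _ _ (asym_smooth_at N t x Z)).
  apply: ge_inf; last by exists Z.
  exists (-1) => _ [Z' _ <-]; rewrite /asym_smooth_at.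
  have : 0 <= sup [set N (x + t *: z) | z in Z' `&` unit_sphere N].
    by apply: sup_ge0_of => _ [z _ <-].
  lra.
rewrite /asym_smooth_at; set V := (V in sup V - 1).
suff : sup V <= 1 + c by lra.
have [[v Vv]|/forallNP V0] := pselect (exists v, V v); last first.
  have -> : V = set0 by apply/seteqP; split=> // v /V0.
  by rewrite sup0; lra.
apply: ge_sup; first by exists v.
by move=> _ [z [Zz Nz] <-]; exact: ZP.
Qed.

Lemma asym_smooth_norm_lt t c x : 0 <= t -> asym_smooth (fun x : X => `|x|) t < c ->
  `|x| = 1 -> exists2 Z, closed_finite_codim_subspace Z &
     forall z, Z z -> `|z| = 1 -> `|x + t *: z| < 1 + c.
Proof.
move=> t0 tc x1.
have at_le z y : `|y| = 1 -> `|z| = 1 -> `|y + t *: z| <= 1 + t.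
  move=> y1 z1; apply: le_trans (ler_normD _ _) _.
  by rewrite normrZ y1 z1 mulr1 ger0_norm.
have at_ub y Z : `|y| = 1 -> asym_smooth_at (fun x : X => `|x|) t y Z <= t.
  move=> y1; rewrite /asym_smooth_at; set V := (V in sup V - 1).
  suff : sup V <= 1 + t by lra.
  have [[v Vv]|/forallNP V0] := pselect (exists v, V v); last first.
    have -> : V = set0 by apply/seteqP; split=> // v /V0.
    by rewrite sup0; lra.
  apply: ge_sup; first by exists v.
  by move=> _ [z [_ z1] <-]; exact: at_le.
have at_inf y : has_inf [set asym_smooth_at (fun x : X => `|x|) t y Z
    | Z in @closed_finite_codim_subspace R X].
  split; first by eexists; exists setT => //; exact: setT_closed_finite_codim.
  exists (-1) => _ [Z' _ <-]; rewrite /asym_smooth_at.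
  have : 0 <= sup [set `|y + t *: z| | z in Z' `&` unit_sphere (fun x : X => `|x|)].
    by apply: sup_ge0_of => _ [z _ <-].
  lra.
pose I y := inf [set asym_smooth_at (fun x : X => `|x|) t y Z
    | Z in @closed_finite_codim_subspace R X].
have Ix : I x < c.
  apply: le_lt_trans tc; apply: ub_le_sup; last by exists x.
  exists t => _ [y y1 <-]; apply: le_trans (at_ub y setT y1).
  apply: ge_inf; first by case: (at_inf y).
  by exists setT => //; exact: setT_closed_finite_codim.
have Ix0 : 0 < c - I x by lra.
have [_ [Z Zc <-] ZP] := inf_adherent Ix0 (at_inf x).
exists Z => // z Zz z1.
have : `|x + t *: z| <= sup [set `|x + t *: z| | z in Z `&` unit_sphere (fun x : X => `|x|)].
  apply: ub_le_sup; last by exists z.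
  by exists (1 + t) => _ [w [_ w1] <-]; exact: at_le.
by rewrite -/(I x) /asym_smooth_at in ZP; lra.
Qed.

Lemma infinite_dim_sphere Z N : infinite_dim X -> equivalent_norm N ->
  closed_finite_codim_subspace Z -> exists2 z, Z z & N z = 1.
Proof.
move=> Xi [[_ NZ _] [c1 [C1 [c10 _ cN]]]] [Zs _ [e eP]].
have [[z [Zz z0]]|no] := pselect (exists z, Z z /\ z != 0).
  have N_gt0 : 0 < N z.
    have /andP[+ _] := cN z; apply: lt_le_trans.
    by rewrite mulr_gt0 // normr_gt0.
  exists ((N z)^-1 *: z); first exact: (subspaceZ Zs).
  by rewrite NZ normfV gtr0_norm // mulVf ?gt_eqF.
exfalso; apply: Xi; exists e => x; have [c cP] := eP x; exists c => /=.
by apply/eqP; apply: contra_notT no => z0; eexists; split; [exact: cP|].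
Qed.

End AsymSmooth.

(** * The renorming *)

Section Renorming.
Context {R : realType} {Y : normedModType R}.
Variables (Lam : R) (Theta : nat -> (Y -> R) -> R) (w r : nat -> R).
Hypothesis Lam_ge1 : 1 <= Lam.
Hypothesis ThetaP : forall i, lsc_gauge Lam (Theta i).
Hypothesis r_bounds : forall i, 0 < r i <= 1 / 2.
Hypothesis w_gt0 : forall i, 0 < w i.
Hypothesis w_sum : forall n, \sum_(i < n) w i <= 1.
Let tau i : R := 2^-1 ^+ i.
Hypothesis gain : forall i u, dual_ball u -> exists E, forall v, dual_ball v ->
  close_on E v u -> (exists y, tau i * `|y| < v y - u y) ->
  Theta i u + tau i * r i / (64 * Lam) <= Theta i v.

Let ball1 : set Y := [set y | `|y| <= 1].
Let dual_norm := support_fun ball1.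

Let ball1_neq0 : ball1 !=set0. Proof. by exists 0; rewrite /ball1 /= normr0. Qed.
Let ball1N a : ball1 a -> ball1 (- a). Proof. by rewrite /ball1 /= normrN. Qed.
Let ball1_le a : ball1 a -> `|a| <= 1. Proof. by []. Qed.

Let dual_norm_gauge : lsc_gauge 1 dual_norm.
Proof. exact: support_gauge. Qed.

Let dual_norm_ge u y : dual_ball u -> u y <= dual_norm u * `|y|.
Proof.
move=> ub; have us : scalar u by case: ub.
have [->|y0] := eqVneq y 0; first by rewrite (scalar_form0 us) normr0 mulr0.
have y1 : ball1 (`|y|^-1 *: y).
  by rewrite /ball1 /= normrZ normfV normr_id mulVf ?normr_eq0.
have := support_ge ball1_neq0 ball1_le ub y1.
by rewrite (scalar_formZ _ _ us) ler_pdivrMl ?normr_gt0 // mulrC.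
Qed.

(** Partial sums of the new dual norm; bounding all of them in [B] replaces a bound on the
    series. *)
Let T n u := dual_norm u + \sum_(i < n) w i * Theta i u.
Let B : set (Y -> R) := [set u | dual_ball u /\ forall n, T n u <= 1].

Let Theta_ge0 i u : dual_ball u -> 0 <= Theta i u <= Lam.
Proof. by case: (ThetaP i) => h _ _; exact: h. Qed.

Let T_scale n u c : dual_ball u -> dual_ball (fun y => c * u y) ->
  T n (fun y => c * u y) <= `|c| * T n u.
Proof.
move=> ub cub; rewrite /T mulrDr; apply: lerD.
  by case: dual_norm_gauge => _ h _; exact: h.
rewrite mulr_sumr; apply: ler_sum => i _; rewrite mulrCA ler_wpM2l ?(ltW (w_gt0 i)) //.
by case: (ThetaP i) => _ h _; exact: h.
Qed.

Let B_scale u c (d : R) : dual_ball u -> (forall n, T n u <= d) ->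
  `|c| * d <= 1 -> B (fun y => c * u y).
Proof.
move=> ub ud cd; have us : scalar u by case: ub.
have cub : dual_ball (fun y => c * u y).
  split; first exact: scalar_form_scale.
  move=> y; apply: le_trans (ler_norm _) _; rewrite normrM.
  have d1 : dual_norm u <= d by have := ud 0%N; rewrite /T big_ord0 addr0.
  have : `|u y| <= dual_norm u * `|y|.
    by apply: scalar_form_abs => // z; exact: dual_norm_ge.
  move=> /(ler_wpM2l (normr_ge0 c)) /le_trans; apply.
  rewrite mulrA -[leRHS]mul1r ler_wpM2r //; apply: le_trans cd.
  by rewrite ler_wpM2l.
split=> // n; apply: le_trans (T_scale n ub cub) _; apply: le_trans cd.
by rewrite ler_wpM2l.
Qed.

Let N y := sup [set u y | u in B].

Let B_abs u y : B u -> `|u y| <= `|y|.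
Proof. by case=> ub _; exact: dual_ball_abs. Qed.

Let T_le n u : dual_ball u -> T n u <= 1 + Lam.
Proof.
move=> ub; apply: lerD; first by case: dual_norm_gauge => /(_ u ub) /andP[].
rewrite -[leRHS]mul1r; have := w_sum n; have L0 : 0 <= Lam by have := Lam_ge1; lra.
move=> /(ler_wpM2r L0); apply: le_trans; rewrite mulr_suml.
apply: ler_sum => i _; rewrite ler_wpM2l ?(ltW (w_gt0 i)) //.
by have /andP[] := Theta_ge0 i ub.
Qed.

Let B0 : B (fun=> 0).
Proof.
have z : dual_ball (fun _ : Y => 0 : R) by split=> [a x y|y] //=; rewrite mulr0 addr0.
have := @B_scale (fun=> 0) 0 (1 + Lam) z; rewrite normr0 !mul0r.
by apply=> // n; exact: T_le.
Qed.

Let N_has_sup y : has_sup [set u y | u in B].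
Proof.
split; first by exists 0; exists (fun=> 0) => //; exact: B0.
exists `|y| => _ [u uB <-]; exact: le_trans (ler_norm _) (B_abs y uB).
Qed.

Let N_ge u y : B u -> u y <= N y.
Proof. by move=> uB; apply: ub_le_sup; [case: (N_has_sup y)|exists u]. Qed.

Let N_le c y : (forall u, B u -> u y <= c) -> N y <= c.
Proof.
by move=> h; apply: ge_sup; [case: (N_has_sup y)|move=> _ [u uB <-]; exact: h].
Qed.

Let N_ge0 y : 0 <= N y. Proof. exact: (N_ge y B0). Qed.

Let N_lower y : `|y| <= (1 + Lam) * N y.
Proof.
have L0 : 0 < 1 + Lam by have := Lam_ge1; lra.
have [u [us ub uy]] := norming_form y.
have ud : dual_ball u by [].
have := @N_ge (fun z => (1 + Lam)^-1 * u z) y; rewrite uy ler_pdivrMl //; apply.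
apply: (@B_scale _ _ (1 + Lam)) => // [n|]; first exact: T_le.
by rewrite gtr0_norm ?invr_gt0 // mulVf ?gt_eqF.
Qed.

Let N_upper y : N y <= `|y|.
Proof. by apply: N_le => u uB; apply: le_trans (ler_norm _) (B_abs y uB). Qed.

Let N_equiv : equivalent_norm N.
Proof.
have L0 : 0 < 1 + Lam by have := Lam_ge1; lra.
split; last first.
  exists (1 + Lam)^-1, 1; split=> // [|y]; first by rewrite invr_gt0.
  by rewrite ler_pdivrMl // N_lower mul1r N_upper.
have NZ a y : N (a *: y) <= `|a| * N y.
  apply: N_le => u uB; have [ub uT] := uB.
  rewrite scalar_formZ; last by case: ub.
  have [a0|a0] := leP 0 a; first by rewrite ger0_norm // ler_wpM2l // N_ge.
  rewrite ltr0_norm // -mulrNN ler_wpM2l ?oppr_ge0 ?(ltW a0) //.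
  rewrite -mulN1r; apply: (@N_ge (fun y => -1 * u y)).
  by apply: (@B_scale _ _ 1) => //; rewrite normrN normr1 mulr1.
split=> [x y|a y|y Ny].
- apply: N_le => u uB; rewrite scalar_formD; last by case: uB => -[].
  by apply: lerD; exact: N_ge.
- apply/eqP; rewrite eq_le NZ /=; have [->|a0] := eqVneq a 0.
    by rewrite normr0 mul0r.
  have := NZ a^-1 (a *: y); rewrite scalerA mulVf // scale1r normfV.
  by rewrite ler_pdivlMl // normr_gt0.
by apply/eqP; rewrite -normr_le0; have := N_lower y; rewrite Ny mulr0.
Qed.

Let tau_gt0 i : 0 < tau i. Proof. by rewrite exprn_gt0. Qed.

Let w_tail (e : R) : 0 < e -> exists n0, forall n, \sum_(i < n) w (n0 + i) <= e.
Proof.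
move=> e0; pose S := [set \sum_(i < n) w i | n in [set: nat]].
have hS : has_sup S.
  split; first by exists (\sum_(i < 0) w i), 0%N.
  by exists 1 => _ [n _ <-].
have [_ [n0 _ <-] h] := sup_adherent e0 hS.
exists n0 => n; have : \sum_(i < n0 + n) w i <= sup S.
  by apply: ub_le_sup; [case: hS|exists (n0 + n)%N].
rewrite big_split_ord /=; lra.
Qed.

(** Chosen so that the bound [t * (2 * tau i * (1 + Lam))] on [t * v z] is exactly a quarter of
    [C * t * tau i / (64 * Lam)], which is at most the gain at level [i]. *)
Let C := 512 * Lam * (1 + Lam).

(** The premise [dual_ball u] comes after [exists E] so that choice yields tests for every [u], as
    [dual_ball_finite_cover] expects. *)
Lemma finite_cover_at y (e : R) n0 : 0 < e ->
  forall u, exists E, dual_ball u -> forall v, dual_ball v -> close_on E v u ->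
  [/\ `|v y - u y| <= e, dual_norm u - e <= dual_norm v,
     forall i, (i < n0)%N -> Theta i u - e <= Theta i v &
     forall i, (i < n0)%N -> (exists y, tau i * `|y| < v y - u y) ->
       Theta i u + tau i * r i / (64 * Lam) <= Theta i v].
Proof.
move=> e0 u; have [ub|nub] := pselect (dual_ball u); last by exists [::].
have us : scalar u by case: ub.
have [E1 E1P] : exists E, forall v, dual_ball v -> close_on E v u ->
    dual_norm u - e <= dual_norm v.
  by case: dual_norm_gauge => _ _ h; exact: h.
have /choice[E2 E2P] : forall i, exists E, forall v, dual_ball v -> close_on E v u ->
    Theta i u - e <= Theta i v.
  by move=> i; case: (ThetaP i) => _ _ h; exact: h.
have /choice[E3 E3P] := fun i => gain i ub.
exists ((e^-1 *: y) :: E1 ++ flatten [seq E2 i ++ E3 i | i <- iota 0 n0]) => _ v vb.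
rewrite -cat1s => /close_on_cat[vy /close_on_cat[v1 v2]].
have v23 i : (i < n0)%N -> close_on (E2 i ++ E3 i) v u.
  move=> ni z zE; apply: v2; apply/flattenP; exists (E2 i ++ E3 i) => //.
  by apply: map_f; rewrite mem_iota.
split=> [|||].
- have vs : scalar v by case: vb.
  have := vy _ (mem_head _ _); rewrite (scalar_formZ _ _ us) (scalar_formZ _ _ vs).
  by rewrite -mulrBr normrM gtr0_norm ?invr_gt0 // ltr_pdivrMl // mulr1 => /ltW.
- exact: E1P.
- by move=> i /v23 /close_on_cat[h _]; exact: E2P.
- by move=> i /v23 /close_on_cat[_ h]; exact: E3P.
Qed.

(* If [v] in [B] is weak* close to [u] and [v - u] is not bounded by [tau i], then
   the gain at level [i] leaves room to enlarge [u], so that [u y], and with it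
   [v y], is smaller than [N y] by an amount proportional to [w i * tau i * r i].
   For the least such [i] this compensates [t * (v - u) z <= 2 * t * tau i * |z|]. *)
Lemma renorming : exists N' : Y -> R, equivalent_norm N' /\
  exists C' : R, 0 < C' /\ forall j t, 0 < t ->
    (forall i, (i <= j)%N -> C' * t <= w i * r i) ->
    asym_smooth N' t <= C' * t * 2^-1 ^+ j.
Proof.
have L1 := Lam_ge1; have L0 : 0 < Lam by lra.
have C0 : 0 < C by apply: mulr_gt0; lra.
exists N; split; first exact: N_equiv.
exists C; split=> // j t t0 tw.
apply: asym_smooth_le => //; first by rewrite mulr_ge0 ?exprn_ge0 // ltW // mulr_gt0.
(* Whichever level [i <= j] occurs below, [e] is at most a sixteenth of its gain [d], since
   [tau j <= tau i]. *)
move=> y Ny; pose e : R := C * t * tau j / (1024 * Lam).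
have e0 : 0 < e.
  by rewrite /e; apply: divr_gt0; [apply: mulr_gt0; [exact: mulr_gt0|exact: tau_gt0]|lra].
have e0L : 0 < e / Lam by rewrite divr_gt0.
have [n1 n1P] := w_tail e0L; pose n0 := (n1 + j.+1)%N.
have n0P n : \sum_(i < n) w (n0 + i) <= e / Lam.
  apply: le_trans (n1P (j.+1 + n)%N); rewrite big_split_ord /=.
  rewrite -[leLHS]add0r lerD //; first by apply: sumr_ge0 => i _; exact: ltW.
  by under eq_bigr do rewrite /n0 -addnA.
have /choice[E EP] := finite_cover_at y n0 e0.
have [m [us [usb usP]]] := dual_ball_finite_cover E.
(* On the common kernel of the centres, [v z] equals [(v - u) z] for the centre [u] close to [v];
   one subspace thus serves all [v]. *)
exists [set x | forall i, us i x = 0].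
  apply: (@closed_finite_codim_kers _ _ _ us 1) => i; have [h1 h2] := usb i.
  by split=> // x; rewrite mul1r.
move=> z uz Nz; apply: N_le => v [vb vT].
have [l vl] := usP v vb; have ub := usb l.
have [vy vn vTh vG] := EP _ ub v vb vl.
set u := us l in ub vy vn vTh vG.
have uz0 : u z = 0 by exact: uz.
have [vs us_] : scalar v /\ scalar u by case: vb; case: ub.
rewrite (scalar_formD _ _ vs) (scalar_formZ _ _ vs).
have vy1 : v y <= 1 by rewrite -Ny; apply: N_ge.
have zn : `|z| <= 1 + Lam by have := N_lower z; rewrite Nz mulr1.
have [nP|/existsNP[y' /negP]] := pselect (forall y', v y' - u y' <= tau j * `|y'|).
  have h : v z <= tau j * (1 + Lam).
    have := nP z; rewrite uz0 subr0 => /le_trans; apply.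
    by rewrite ler_wpM2l // ltW.
  have : t * v z <= t * (tau j * (1 + Lam)) by rewrite ler_wpM2l // ltW.
  have : t * (tau j * (1 + Lam)) <= C * t * tau j.
    rewrite mulrA [t * tau j * _]mulrC -[C * t * _]mulrA ler_wpM2r //.
      by rewrite mulr_ge0 ?ltW.
    by rewrite /C ler_peMl //; lra.
  rewrite -/(tau j); lra.
rewrite -ltNge => y'P.
pose P i := `[< exists y, tau i * `|y| < v y - u y >].
have exP : exists i, P i by exists j; apply/asboolP; exists y'.
pose i := ex_minn exP.
have [iP i_min] : P i /\ forall k, P k -> (i <= k)%N by rewrite /i; case: ex_minnP.
have ij : (i <= j)%N by apply: i_min; apply/asboolP; exists y'.
have in0 : (i < n0)%N by rewrite /n0 addnS ltnS (leq_trans ij) ?leq_addl.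
(* Level [i - 1] fails by minimality, and its [tau] is [2 * tau i]; at level 0 the bound of the dual
   ball suffices. *)
have vzb : v z <= 2 * tau i * (1 + Lam).
  have h2 : 2 * tau i * `|z| <= 2 * tau i * (1 + Lam).
    by rewrite ler_wpM2l // mulr_ge0 // ltW.
  apply: le_trans h2; case: (i) i_min => [|k] i_min.
    rewrite /tau expr0 mulr1; have := dual_ball_abs z vb; have := normr_ge0 z.
    by have := ler_norm (v z); lra.
  have -> : 2 * tau k.+1 = tau k by rewrite /tau exprS mulrA divff // mul1r.
  rewrite leNgt; apply/negP => hk.
  have : P k by apply/asboolP; exists z; rewrite uz0 subr0.
  by move=> /i_min; rewrite ltnn.
have G := vG i in0 (asboolW iP).
pose d := w i * (tau i * r i / (64 * Lam)).
have [/andP[ri0 ri1] wi0] := (r_bounds i, w_gt0 i).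
have ti0 := tau_gt0 i.
have wi1 : w i <= 1.
  apply: le_trans (w_sum i.+1); rewrite big_ord_recr /= lerDr.
  by apply: sumr_ge0 => k _; exact: ltW.
have ti1 : tau i <= 1 by rewrite exprn_ile1 //; lra.
have tij : tau j <= tau i by rewrite /tau ler_wiXn2l //; lra.
pose K := tau i / (64 * Lam); pose Kj := tau j / (64 * Lam).
have iL0 : 0 < (64 * Lam)^-1 by rewrite invr_gt0; lra.
have K0 : 0 < K by apply: mulr_gt0.
have KjK : Kj <= K by rewrite /Kj /K ler_wpM2r // ltW.
have K1 : K <= 1 / 64.
  by rewrite /K ler_pdivrMr; lra.
have dE : d = w i * r i * K by rewrite /d /K; lra.
have wr0 : 0 < w i * r i by exact: mulr_gt0.
have d0 : 0 < d by rewrite dE; exact: mulr_gt0.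
have d_ge : C * t * K <= d by rewrite dE ler_wpM2r ?(ltW K0) //; exact: tw.
have d_le : d <= 1 / 2.
  have h1 : w i * r i <= r i by rewrite ler_piMl // ltW.
  have h2 : w i * r i * K <= w i * r i * (1 / 64) by rewrite ler_wpM2l // ltW.
  by rewrite dE; lra.
have Ct0 : 0 < C * t by exact: mulr_gt0.
have e_le : e <= d / 16.
  have : C * t * Kj <= C * t * K by rewrite ler_wpM2l // ltW.
  have -> : e = C * t * Kj / 16 by rewrite /e /Kj !invfM; lra.
  by lra.
(* Compared with [v], level [i] lowers the sum by [d]; the dual norm, the other levels below [n0]
   and the tail raise it by at most [e] each, and [3 * e <= d / 2]. *)
have uT n : T n u <= 1 - d / 2.
  have tail_ge0 m' k : 0 <= \sum_(a < k) w (m' + a)%N * Theta (m' + a) u.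
    apply: sumr_ge0 => a _; apply: mulr_ge0; first exact: ltW.
    by have /andP[] := Theta_ge0 (m' + a) ub.
  have mono : \sum_(a < n) w a * Theta a u <=
      \sum_(a < n0) w a * Theta a u + \sum_(a < n) w (n0 + a)%N * Theta (n0 + a) u.
    have <- : \sum_(a < n0 + n) w a * Theta a u =
        \sum_(a < n0) w a * Theta a u + \sum_(a < n) w (n0 + a)%N * Theta (n0 + a) u.
      by rewrite big_split_ord.
    by rewrite addnC big_split_ord /= lerDl; exact: tail_ge0.
  have tail_le : \sum_(a < n) w (n0 + a)%N * Theta (n0 + a) u <= e.
    apply: (@le_trans _ _ ((\sum_(a < n) w (n0 + a)) * Lam)).
      rewrite mulr_suml; apply: ler_sum => a _; rewrite ler_wpM2l //; first exact: ltW.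
      by have /andP[] := Theta_ge0 (n0 + a) ub.
    by rewrite -ler_pdivlMr.
  have head : \sum_(a < n0) w a * Theta a u <= \sum_(a < n0) w a * Theta a v + e - d.
    rewrite (bigD1 (Ordinal in0)) //= [in leRHS](bigD1 (Ordinal in0)) //=.
    have hi : w i * Theta i u <= w i * Theta i v - d.
      by have := ler_wpM2l (ltW wi0) G; rewrite mulrDr -/d; lra.
    have others : \sum_(a < n0 | a != Ordinal in0) w a * Theta a u <=
        \sum_(a < n0 | a != Ordinal in0) w a * Theta a v +
        (\sum_(a < n0 | a != Ordinal in0) w a) * e.
      rewrite mulr_suml -big_split /=; apply: ler_sum => a _.
      rewrite -mulrDr ler_wpM2l //; first exact: ltW.
      by have := vTh a (ltn_ord a); lra.
    have wo : (\sum_(a < n0 | a != Ordinal in0) w a) * e <= 1 * e.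
      apply: ler_wpM2r; first exact: ltW.
      apply: le_trans (w_sum n0); rewrite [leRHS](bigD1 (Ordinal in0)) //= lerDr.
      exact: ltW.
    lra.
  by have := vT n0; rewrite /T; lra.
have uB : B (fun y => (1 - d / 2)^-1 * u y).
  apply: (@B_scale _ _ (1 - d / 2)) => //.
  have h : 0 < 1 - d / 2 by lra.
  by rewrite gtr0_norm ?invr_gt0 // mulVf ?gt_eqF.
have uy : u y <= 1 - d / 2.
  have := N_ge y uB; rewrite Ny ler_pdivrMl ?mulr1 //; lra.
have vu : v y <= u y + e by move: vy; rewrite ler_norml; lra.
have tv : t * v z <= d / 4.
  have : t * v z <= t * (2 * tau i * (1 + Lam)) by rewrite ler_wpM2l // ltW.
  have <- : C * t * K / 4 = t * (2 * tau i * (1 + Lam)).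
    have -> : C * t * K / 4 = Lam / Lam * (t * (2 * tau i * (1 + Lam))).
      by rewrite /C /K !invfM; lra.
    by rewrite divff ?mul1r // gt_eqF.
  by lra.
have : 0 < C * t * 2^-1 ^+ j by apply: mulr_gt0 => //; exact: tau_gt0.
lra.
Qed.

End Renorming.

(** * Transfer of asymptotic smoothness *)

Section EquivalentNorm.
Context {R : realType} {X : normedModType R}.
Variable N : X -> R.
Hypothesis N_equiv : equivalent_norm N.

Lemma equivalent_norm_ge0 x : 0 <= N x.
Proof.
have [_ [c [C [c0 _ /(_ x)/andP[+ _]]]]] := N_equiv; apply: le_trans.
by rewrite mulr_ge0 // ltW.
Qed.

Lemma asym_smooth_le_id t : 0 <= t -> asym_smooth N t <= t.
Proof.
move=> t0; have [[ND NZ _] _] := N_equiv.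
apply: asym_smooth_le => // [x|x Nx]; first exact: equivalent_norm_ge0.
exists setT => [|z _ Nz]; first exact: setT_closed_finite_codim.
by apply: le_trans (ND _ _) _; rewrite NZ Nx Nz mulr1 ger0_norm.
Qed.

(** As [x] is the mean of [x + t *: z] and [x - t *: z], one of these has norm at least 1; infinite
    dimension provides [z] in every [Z]. *)
Lemma asym_smooth_ge0 t : infinite_dim X -> 0 <= asym_smooth N t.
Proof.
move=> Xinf; have [[ND NZ _] _] := N_equiv.
apply: sup_ge0_of => _ [x Nx <-]; apply: lb_le_inf.
  by eexists; exists setT => //; exact: setT_closed_finite_codim.
move=> _ [Z Zc <-]; have [Zs _ _] := Zc.
have [z Zz Nz] := infinite_dim_sphere Xinf N_equiv Zc.
rewrite /asym_smooth_at; set V := (V in sup V - 1).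
have Vub : has_ubound V.
  exists (1 + `|t|) => _ [y [_ Ny] <-].
  by apply: le_trans (ND _ _) _; rewrite NZ Nx Ny mulr1.
have h1 : N (x + t *: z) <= sup V by apply: ub_le_sup => //; exists z.
have h2 : N (x - t *: z) <= sup V.
  apply: ub_le_sup => //; exists (- z); last by rewrite scalerN.
  split; first by rewrite -scaleN1r; exact: (subspaceZ Zs).
  by rewrite /unit_sphere /= -scaleN1r NZ normrN normr1 mul1r.
have : N (x + t *: z + (x - t *: z)) <= 2 * sup V.
  by apply: le_trans (ND _ _) _; lra.
rewrite addrACA subrr addr0 -mulr2n -scaler_nat NZ Nx ger0_norm //; lra.
Qed.

End EquivalentNorm.

Lemma norm_equivalent_norm (R : realType) (X : normedModType R) :
  equivalent_norm (fun x : X => `|x|).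
Proof.
split; last by exists 1, 1; split=> // x; rewrite mul1r lexx.
split=> [x y|a x|x /eqP]; [exact: ler_normD|exact: normrZ|].
by rewrite normr_eq0 => /eqP.
Qed.

Lemma infinite_dim_neq0 (R : realType) (X : lmodType R) : infinite_dim X ->
  exists x : X, x != 0.
Proof.
move=> Xinf; apply: contrapT => /forallNP h; apply: Xinf; exists [::] => x.
by exists (fun=> 0); rewrite big_ord0 subr0; apply/eqP; rewrite -[_ == _]negbK; apply/negP/h.
Qed.

Lemma net_near (R : realType) (X : normedModType R) (M : set X) : is_net M ->
  exists2 b : R, 0 < b & forall x, exists2 z, M z & `|x - z| < b.
Proof.
move=> [a [b [/andP[a0 ab] [_ h]]]]; exists b; first exact: lt_le_trans ab.
by move=> x; have /ereal_inf_lt[_ [z Mz <-]] := h x; rewrite lte_fin; exists z.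
Qed.

Lemma lipschitz_bound (R : realType) (X Y : normedModType R) (M : set X)
    (f : X -> Y) : [lipschitz f x | x in M] ->
  exists k0 : R, forall k, k0 <= k ->
    forall x x', M x -> M x' -> `|f x - f x'| <= k * `|x - x'|.
Proof.
move=> [k0 [_ h]]; exists (k0 + 1) => k kk x x' Mx Mx'.
have k0k : k0 < k by lra.
exact: (h k k0k (x, x')).
Qed.

Lemma net_equivalent_nets (R : realType) (X Y : normedModType R) :
  net_equivalent X Y -> exists M L f g Lam beta,
    @lipschitz_nets R X Y M L f g Lam beta.
Proof.
move=> [M [L [/net_near[b b0 Mb] /net_near[b' b'0 Lb]]]].
move=> [f [g [[fML finj fsurj] fK /lipschitz_bound[k kP] /lipschitz_bound[k' kP']]]].
pose Lam : R := 1 + `|k| + `|k'|.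
have [k1 k2] : k <= Lam /\ k' <= Lam.
  have := ler_norm k; have := ler_norm k'; have := normr_ge0 k; have := normr_ge0 k'.
  by rewrite /Lam; lra.
have fK' x : M x -> g (f x) = x by move=> Mx; apply: fK; rewrite inE.
exists M, L, f, g, Lam, (b + b'); split.
- by have := normr_ge0 k; have := normr_ge0 k'; rewrite /Lam; lra.
- by lra.
- by move=> x; have [z Mz h] := Mb x; exists z => //; lra.
- by move=> y; have [z Lz h] := Lb y; exists z => //; lra.
- by move=> x Mx; apply: fML.
- by move=> y /fsurj[x Mx <-]; rewrite fK'.
- exact: fK'.
- by move=> y /fsurj[x Mx <-]; rewrite fK'.
- by move=> x x' Mx Mx'; exact: kP.
- by move=> y y' Ly Ly'; exact: kP'.
Qed.

Section Transfer.
Context {R : realType} {X Y : normedModType R}.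
Variables (M : set X) (L : set Y) (f : X -> Y) (g : Y -> X) (Lam beta : R).
Hypothesis nets : lipschitz_nets M L f g Lam beta.
Hypothesis X_nontrivial : exists x : X, x != 0.

(** By convexity, since [x + w] lies between [x] and some [x + r *: z] with [z] on the sphere. The
    factor 2 between the two bounds leaves room for an infimum over subspaces that is only
    approached. *)
Lemma smooth_at_scale (tau r : R) : 0 < tau -> 0 < r ->
  asym_smooth (fun x : X => `|x|) r <= tau * r / (64 * Lam ^+ 2) ->
  forall x : X, `|x| = 1 ->
  exists2 X0, @closed_finite_codim_subspace R X X0 &
    forall w, X0 w -> `|w| <= r -> `|x + w| <= 1 + tau * r / (32 * Lam ^+ 2).
Proof.
have Lam1 := nets_Lam_ge1 nets.
move=> tau0 r0 h x x1; set c := tau * r / (32 * Lam ^+ 2).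
have tr0 : 0 < tau * r by exact: mulr_gt0.
have L2 : 0 < Lam ^+ 2 by rewrite exprn_gt0 //; lra.
have iL2 : 0 < (Lam ^+ 2)^-1 by rewrite invr_gt0.
have ti : 0 < tau * r * (Lam ^+ 2)^-1 by exact: mulr_gt0.
have c0 : 0 < c by rewrite /c invfM; lra.
have hc : asym_smooth (fun x : X => `|x|) r < c.
  by apply: le_lt_trans h _; rewrite /c !invfM; lra.
have [Z Zc ZP] := asym_smooth_norm_lt (ltW r0) hc x1.
have [Zs _ _] := Zc; exists Z => // w Zw wr.
have [->|w0] := eqVneq w 0; first by rewrite addr0 x1; lra.
have w_gt0 : 0 < `|w| by rewrite normr_gt0.
pose s := `|w| / r; pose z := `|w|^-1 *: w.
have z1 : `|z| = 1 by rewrite normrZ normfV normr_id mulVf // gt_eqF.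
have s0 : 0 <= s by rewrite divr_ge0 // ltW.
have s1 : s <= 1 by rewrite ler_pdivrMr // mul1r.
have -> : x + w = (1 - s) *: x + s *: (x + r *: z).
  rewrite scalerDr addrA -scalerDl subrK scale1r scalerA /s divfK ?gt_eqF //.
  by rewrite scalerA divff ?scale1r // gt_eqF.
apply: le_trans (ler_normD _ _) _; rewrite (normrZ s) (normrZ (1 - s)) x1 mulr1.
rewrite (ger0_norm s0) ger0_norm; last by lra.
have : s * `|x + r *: z| <= s * (1 + c).
  rewrite ler_wpM2l // ltW // ZP //; exact: (subspaceZ Zs).
have : s * c <= 1 * c by rewrite ler_wpM2r // ltW.
lra.
Qed.

Lemma transfer_renorming (w r : nat -> R) :
  (forall i, 0 < r i <= 1 / 2) -> (forall i, 0 < w i) ->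
  (forall n, \sum_(i < n) w i <= 1) ->
  (forall i, asym_smooth (fun x : X => `|x|) (r i) <=
     2^-1 ^+ i * r i / (64 * Lam ^+ 2)) ->
  exists N : Y -> R, equivalent_norm N /\
  exists C : R, 0 < C /\ forall j t, 0 < t ->
    (forall i, (i <= j)%N -> C * t <= w i * r i) ->
    asym_smooth N t <= C * t * 2^-1 ^+ j.
Proof.
move=> rP w0 w1 sm; have Lam1 := nets_Lam_ge1 nets.
have /choice[phis phisP] : forall i, exists phi : (Y -> R) -> R,
    lsc_gauge Lam phi /\ forall u, dual_ball u -> exists E, forall v,
    dual_ball v -> close_on E v u -> (exists y, 2^-1 ^+ i * `|y| < v y - u y) ->
    phi u + 2^-1 ^+ i * r i / (64 * Lam) <= phi v.
  move=> i; have /andP[r0 r1] := rP i.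
  have t0 : 0 < 2^-1 ^+ i :> R by rewrite exprn_gt0.
  apply: (gain_gauge nets X_nontrivial t0 r0 r1).
  exact: smooth_at_scale.
apply: (renorming Lam1 (fun i => (phisP i).1) rP w0 w1) => i.
exact: (phisP i).2.
Qed.

End Transfer.

(** * Choice of the radii and weights *)

Lemma half_exp_small (R : realType) (e : R) : 0 < e -> exists n, 2^-1 ^+ n < e.
Proof.
move=> e0; exists (Num.truncn e^-1).+1; rewrite exprVn invf_plt ?posrE ?exprn_gt0 //.
apply: lt_le_trans (truncnS_gt _) _.
by rewrite -natrX ler_nat; exact/ltnW/ltn_expl.
Qed.

Section GeometricWeights.
Context {R : realType}.
Variable lam : R.
Hypothesis lam_bounds : 0 < lam < 1.

Lemma geometric_weight_gt0 i : 0 < (1 - lam) * lam ^+ i.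
Proof. by case/andP: lam_bounds => h1 h2; rewrite mulr_gt0 ?subr_gt0 ?exprn_gt0. Qed.

Lemma geometric_weight_sum n : \sum_(i < n) (1 - lam) * lam ^+ i <= 1.
Proof.
case/andP: lam_bounds => h1 h2; rewrite -mulr_sumr -opprB mulNr -subrX1 opprB.
by have : 0 < lam ^+ n; [rewrite exprn_gt0|lra].
Qed.

End GeometricWeights.

Section AUSTransfer.
Context {R : realType} {X Y : normedModType R}.
Hypothesis X_infinite : infinite_dim X.
Hypothesis Y_infinite : infinite_dim Y.
Hypothesis XY : net_equivalent X Y.

(** The radii come without any rate. This is enough, because for a fixed [j] only the finitely many
    conditions with [i <= j] are imposed, and they hold for all small [t]. *)
Lemma AUS_transfer : AUS (fun x : X => `|x|) ->
  exists N : Y -> R, equivalent_norm N /\ AUS N.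
Proof.
move=> XA; have [M [L [f [g [Lam [beta nets]]]]]] := net_equivalent_nets XY.
have Lam1 := nets_Lam_ge1 nets.
have L2 : 0 < 64 * Lam ^+ 2 by rewrite mulr_gt0 // exprn_gt0 //; lra.
have /choice[r rP] : forall i, exists r : R, 0 < r <= 1 / 2 /\
    asym_smooth (fun x : X => `|x|) r <= 2^-1 ^+ i * r / (64 * Lam ^+ 2).
  move=> i; have e0 : 0 < 2^-1 ^+ i / (64 * Lam ^+ 2) :> R by rewrite divr_gt0 // exprn_gt0.
  have near_small : \forall r \near (0:R)^'+,
      `|asym_smooth (fun x : X => `|x|) r / r| <= 2^-1 ^+ i / (64 * Lam ^+ 2).
    by move: XA; rewrite /AUS => /cvgr0_norm_le; apply.
  near (0:R)^'+ => r; exists r.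
  have r0 : 0 < r by near: r; exact: nbhs_right_gt.
  have r1 : r < 1 / 2 by near: r; apply: nbhs_right_lt; lra.
  split; first by rewrite r0 ltW.
  have : `|asym_smooth (fun x : X => `|x|) r / r| <= 2^-1 ^+ i / (64 * Lam ^+ 2).
    by near: r; exact: near_small.
  move=> /(le_trans (ler_norm _)); rewrite ler_pdivrMr //.
  by rewrite mulrAC.
have lamP : 0 < (2^-1 : R) < 1 by lra.
have [N [Ne [C [C0 NP]]]] := transfer_renorming nets (infinite_dim_neq0 X_infinite)
  (fun i => (rP i).1) (geometric_weight_gt0 lamP) (geometric_weight_sum lamP)
  (fun i => (rP i).2).
exists N; split=> //; apply/cvgr0Pnorm_le => e e0.
have eC : 0 < e / C by exact: divr_gt0.
have [j jP] := half_exp_small eC.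
have small : \forall t \near (0:R)^'+,
    forall i : 'I_j.+1, C * t <= (1 - 2^-1) * 2^-1 ^+ i * r i.
  apply: filter_forall => i; near=> t.
  rewrite mulrC -ler_pdivlMr //; apply: ltW; near: t; apply: nbhs_right_lt.
  rewrite divr_gt0 // mulr_gt0 //; first exact: geometric_weight_gt0.
  by have [/andP[]] := rP i.
near=> t.
have t0 : 0 < t by near: t; exact: nbhs_right_gt.
rewrite ger0_norm; last by rewrite divr_ge0 ?(ltW t0) // asym_smooth_ge0.
rewrite ler_pdivrMr //; apply: le_trans (NP j t t0 _) _; last first.
  rewrite -mulrA mulrCA mulrC ler_wpM2r ?(ltW t0) //.
  by rewrite mulrC -ler_pdivlMr // ltW.
have small_t : forall i : 'I_j.+1, C * t <= (1 - 2^-1) * 2^-1 ^+ i * r i.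
  by near: t; exact: small.
by move=> i ij; exact: (small_t (Ordinal (ij : (i < j.+1)%N))).
Unshelve. all: by end_near. Qed.

(* The radii solve [C r^(p-1) ~ 2^-i], and the ratio [lam] of the weights is chosen
   so that [w i * r i] is proportional to [2^(-i / (p' - 1))], with [p' := p - eps];
   then [t ~ w j * r j] means [2^-j ~ t^(p'-1)]. *)
Lemma power_type_transfer (C p : R) : 0 < C -> 1 < p ->
  (forall t : R, 0 < t <= 1 -> asym_smooth (fun x : X => `|x|) t <= C * t `^ p) ->
  forall eps : R, 0 < eps ->
  exists N : Y -> R, equivalent_norm N /\
    exists Ceps : R, 0 < Ceps /\
      forall t : R, 0 < t <= 1 -> asym_smooth N t <= Ceps * t `^ (p - eps).
Proof.
move=> C0 p1 Xp eps eps0; set p' := p - eps.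
(* For [p' <= 1] the original norm will do: its modulus is at most [t]. *)
have [p'1|p'1] := leP p' 1.
  exists (fun y => `|y|); split; first exact: norm_equivalent_norm.
  exists 1; split=> // t /[dup] t01 /andP[t0 t1].
  rewrite mul1r; apply: le_trans (ger1_powR t01 p'1).
  exact: asym_smooth_le_id (norm_equivalent_norm Y) _ (ltW t0).
have [M [L [f [g [Lam [beta nets]]]]]] := net_equivalent_nets XY.
have Lam1 := nets_Lam_ge1 nets.
have L2 : 1 <= 64 * Lam ^+ 2.
  have : 1 <= Lam ^+ 2 by rewrite exprn_ege1.
  lra.
pose a := (p - 1)^-1; pose a' := (p' - 1)^-1.
have a0 : 0 < a by rewrite invr_gt0; lra.
have a'0 : 0 < a' by rewrite invr_gt0; lra.
have aa' : a < a'.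
  by rewrite /a /a' ltf_pV2 ?posrE ?subr_gt0 // /p'; lra.
(* The power of 1/2 ensures [r i <= 1 / 2], the denominator the smoothness required at radius
   [r i]. *)
pose c := 2^-1 `^ (p - 1) / (64 * Lam ^+ 2 * (C + 1)).
have c0 : 0 < c.
  by rewrite divr_gt0 ?powR_gt0 // mulr_gt0; lra.
pose q i : R := 2^-1 ^+ i.
have q0 i : 0 < q i by rewrite exprn_gt0.
have q1 i : q i <= 1 by rewrite exprn_ile1 //; lra.
pose r i := (c * q i) `^ a.
have cq0 i : 0 < c * q i by exact: mulr_gt0.
have r0 i : 0 < r i by exact: powR_gt0.
have rp i : r i `^ (p - 1) = c * q i.
  by rewrite -powRrM /a mulVf ?powRr1 ?(ltW (cq0 i)) //; apply/eqP; lra.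
have c_le : c <= 2^-1 `^ (p - 1).
  rewrite ler_pdivrMr; last by rewrite mulr_gt0; lra.
  rewrite ler_peMr ?powR_ge0 //.
  have : 64 * Lam ^+ 2 * 1 <= 64 * Lam ^+ 2 * (C + 1) by rewrite ler_wpM2l; lra.
  lra.
have r_half i : r i <= 1 / 2.
  have -> : 1 / 2 = (2^-1 `^ (p - 1)) `^ a :> R.
    by rewrite -powRrM /a divff ?powRr1 //; [lra|apply/eqP; lra].
  rewrite /r ge0_ler_powR ?nnegrE ?powR_ge0 ?(ltW a0) ?(ltW (cq0 i)) //.
  by apply: le_trans c_le; rewrite ler_piMr ?(ltW c0).
have rP i : 0 < r i <= 1 / 2 by rewrite r0 r_half.
have sm i : asym_smooth (fun x : X => `|x|) (r i) <= 2^-1 ^+ i * r i / (64 * Lam ^+ 2).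
  have r1 : r i <= 1 by have := r_half i; lra.
  apply: le_trans (Xp (r i) _) _; first by rewrite r0.
  rewrite -mulr_powRB1 ?(ltW (r0 i)) //; last by lra.
  rewrite rp -/(q i) mulrCA [q i * _]mulrC -[leRHS]mulrA ler_wpM2l ?(ltW (r0 i)) //.
  rewrite mulrA mulrC ler_wpM2l ?(ltW (q0 i)) //.
  have P1 : 2^-1 `^ (p - 1) <= 1 :> R.
    have h : 0 < (2^-1 : R) <= 1 by lra.
    have p10 : 0 <= p - 1 by lra.
    by have := ger_powR h p10; rewrite powRr0.
  have CP : C * 2^-1 `^ (p - 1) <= C * 1 by rewrite ler_wpM2l // ltW.
  have -> : C * c = (64 * Lam ^+ 2)^-1 * (C * 2^-1 `^ (p - 1) / (C + 1)).
    by rewrite /c [(_ * (C + 1))^-1]invfM; lra.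
  rewrite ler_piMr ?invr_ge0 //; first by lra.
  by rewrite ler_pdivrMr; lra.
pose lam := 2^-1 `^ (a' - a).
have lamP : 0 < lam < 1.
  have one : 1 `^ (a' - a) = 1 :> R by rewrite powR1.
  rewrite powR_gt0 //= -[ltRHS]one.
  by rewrite gt0_ltr_powR ?nnegrE //; lra.
have [N [Ne [C' [C'0 NP]]]] := transfer_renorming nets (infinite_dim_neq0 X_infinite)
  rP (geometric_weight_gt0 lamP) (geometric_weight_sum lamP) sm.
exists N; split=> //.
pose K := (1 - lam) * c `^ a.
have K0 : 0 < K by case/andP: lamP => _ h; rewrite mulr_gt0 ?powR_gt0 // subr_gt0.
have wr i : (1 - lam) * lam ^+ i * r i = K * q i `^ a'.
  rewrite /r powRM ?(ltW c0) ?(ltW (q0 i)) // /K /lam -powR_mulrn ?powR_ge0 //.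
  rewrite -powRrM [_ * i%:R]mulrC powRrM powR_mulrn ?invr_ge0 // -/(q i).
  rewrite mulrACA -powRD ?subrK //; apply/implyP => _; exact: lt0r_neq0.
pose D := (C' / K) `^ (p' - 1).
have D0 : 0 < D by rewrite powR_gt0 // divr_gt0.
exists (2 * C' * D + D); split; first by rewrite addr_gt0 // mulr_gt0 // mulr_gt0.
move=> t /andP[t0 t1].
(* Since [a'] is inverse to [p' - 1], the condition [C' * t <= w j * r j] reads [s <= q j]. The [j]
   chosen below is the last such level, so [q j < 2 * s]. *)
pose s := (C' * t / K) `^ (p' - 1).
have sE : s = D * t `^ (p' - 1).
  have CK : 0 <= C' / K by rewrite divr_ge0 // ltW.
  have -> : s = (C' / K * t) `^ (p' - 1) by rewrite /s mulrAC.
  by rewrite (powRM _ CK (ltW t0)).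
have tp : t * t `^ (p' - 1) = t `^ p' by rewrite mulr_powRB1 ?(ltW t0) //; lra.
have tp0 : 0 < t `^ p' by exact: powR_gt0.
have CDtp : 0 < C' * (D * t `^ p') by rewrite !mulr_gt0.
(* If [1 <= s], the trivial bound [t] suffices, as [t * s] is [D] times the power [p'] of [t]. *)
have [s1|s1] := leP 1 s.
  apply: le_trans (asym_smooth_le_id Ne (ltW t0)) _.
  have : t * 1 <= t * s by rewrite ler_wpM2l // ltW.
  rewrite sE mulrCA tp; lra.
have s0 : 0 < s by rewrite powR_gt0 // divr_gt0 // mulr_gt0.
pose k := ex_minn (half_exp_small s0).
have [kP kmin] : q k < s /\ forall n, q n < s -> (k <= n)%N by rewrite /k; case: ex_minnP.
have k0 : (0 < k)%N.
  by rewrite lt0n; apply: contraTneq kP => ->; rewrite /q expr0 -leNgt ltW.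
pose j := k.-1.
have sj : s <= q j.
  by rewrite leNgt; apply/negP => /kmin; rewrite /j; case: (k) k0 => //= n _; rewrite ltnn.
have qj : q j = 2 * q k.
  by rewrite /q /j; case: (k) k0 => //= n _; rewrite exprS mulrA divff // mul1r.
have main : asym_smooth N t <= C' * t * q j.
  apply: NP => // i ij; rewrite wr.
  have qij : q j <= q i by rewrite /q ler_wiXn2l //; lra.
  have : K * q j `^ a' <= K * q i `^ a'.
    by rewrite ler_wpM2l ?(ltW K0) // ge0_ler_powR ?nnegrE ?(ltW (q0 _)) ?(ltW a'0).
  apply: le_trans.
  have sa : s `^ a' = C' * t / K.
    rewrite /s -powRrM /a' divff ?powRr1 //; last by apply/eqP; lra.
    by apply: ltW; rewrite divr_gt0 // mulr_gt0.
  rewrite [leRHS]mulrC -ler_pdivrMr // -sa ge0_ler_powR ?nnegrE ?(ltW s0) ?(ltW (q0 _)) ?(ltW a'0) //.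
apply: le_trans main _; rewrite qj.
have : C' * t * (2 * q k) <= C' * t * (2 * s).
  by rewrite ler_wpM2l ?mulr_ge0 ?(ltW C'0) ?(ltW t0) //; lra.
have -> : C' * t * (2 * s) = 2 * C' * D * (t * t `^ (p' - 1)) by rewrite sE; lra.
have : 0 < D * t `^ p' by exact: mulr_gt0.
rewrite tp; lra.
Qed.

End AUSTransfer.

Theorem theorem3p12 (R : realType) (X Y : completeNormedModType R)
    (X_infinite : infinite_dim X) (Y_infinite : infinite_dim Y)
    (XY : net_equivalent X Y) (X_AUS : AUS (fun x : X => `|x|)) :
  (exists N : Y -> R, equivalent_norm N /\ AUS N) /\
  (forall C p : R, 0 < C -> 1 < p ->
    (forall t : R, 0 < t <= 1 ->
       asym_smooth (fun x : X => `|x|) t <= C * t `^ p) ->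
    forall eps : R, 0 < eps ->
    exists N : Y -> R, equivalent_norm N /\
      exists Ceps : R, 0 < Ceps /\
        forall t : R, 0 < t <= 1 ->
          asym_smooth N t <= Ceps * t `^ (p - eps)).
Proof.
split=> [|C p C0 p1 Xp eps eps0].
  exact: AUS_transfer X_infinite Y_infinite XY X_AUS.
exact: power_type_transfer X_infinite XY C p C0 p1 Xp eps eps0.
Qed.
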